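(* For all integers $m \geq 1$ and all integers $n \geq 1$, we have $\tau(n) \neq 5^m$ and $\tau(n) \neq -5^m$.
   Context: $\tau(n)$ denotes the Ramanujan tau-function, defined by $\sum_{n=1}^\infty \tau(n) q^n = q \prod_{n=1}^\infty (1-q^n)^{24}$. *)

(* Defs.v *)
From HB Require Import structures.
From mathcomp Require Import all_boot all_order all_algebra ring.
Set Implicit Arguments.
Unset Strict Implicit.
Unset Printing Implicit Defensive.
Import GRing.Theory.
Local Open Scope ring_scope.

Definition delta_trunc (N : nat) : {poly int} :=
  'X * \prod_(1 <= k < N.+1) (1 - 'X^k) ^+ 24.

(* The infinite product is the limit of [delta_trunc N] for coefficientwise
   convergence of formal power series: by [delta_trunc_stable] below, the
   coefficient of q^n no longer changes once N >= n - 1, so it can be read off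
   at N = n. *)
Definition ramanujan_tau (n : nat) : int := (delta_trunc n)`_n.

Lemma delta_trunc_stable (n N : nat) :
  (n.-1 <= N)%N -> (delta_trunc N)`_n = ramanujan_tau n.
Proof.
have step M : (n <= M.+1)%N -> (delta_trunc M.+1)`_n = (delta_trunc M)`_n.
  move=> leM; rewrite /delta_trunc big_nat_recr //= !coefXM.
  case: n leM => [|k] //= leM.
  set P := \prod_(1 <= i < _) _.
  have [R ->] : exists R : {poly int},
      (1 - 'X^(M.+1)) ^+ 24 = 1 + R * 'X^(M.+1) :> {poly int}.
    elim: 24%N => [|j [R IH]]; first by exists 0; rewrite expr0 mul0r addr0.
    by exists (R - 1 - R * 'X^(M.+1)); rewrite exprS IH; ring.
  by rewrite mulrDr mulr1 mulrA coefD coefMXn leM addr0.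
have aux M d : (n.-1 <= M)%N -> (delta_trunc (M + d))`_n = (delta_trunc M)`_n.
  move=> leM; elim: d => [|d IH]; first by rewrite addn0.
  rewrite addnS step ?IH // (leq_trans (leqSpred n)) // ltnS.
  exact: leq_trans leM (leq_addr _ _).
move=> leN; rewrite /ramanujan_tau -(subnKC leN) aux //.
by have := aux n.-1 (n - n.-1)%N (leqnn _); rewrite subnKC ?leq_pred.
Qed.

Fact ramanujan_tau1 : ramanujan_tau 1 = 1.
Proof.
by rewrite -(@delta_trunc_stable 1 0) // /delta_trunc big_nil mulr1 coefX.
Qed.

(* Main.v *)
Require Import Defs.
From mathcomp Require Import all_boot all_order all_algebra finfield ring lra zify.
Set Implicit Arguments.
Unset Strict Implicit.
Unset Printing Implicit Defensive.
Import Order.TTheory GRing.Theory Num.Theory.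
Local Open Scope ring_scope.

(** Write tau for the Ramanujan function.  It is multiplicative and, for a
prime p, the sequence k |-> tau(p^k) is the Lucas sequence with parameters
P = tau(p) and Q = p^11: u_0 = 1, u_1 = P, u_(k+2) = P u_(k+1) - Q u_k.  If
tau(n) is up to sign a power of 5, then so is tau(p^k) for every prime power
p^k exactly dividing n, and it is enough to show that such a tau(p^k) is 1 or
-1 ([pow5_tau_prime_pow]), because then tau(n) is 1 or -1 as well.

- tau(p) is even, so tau(p^k) can only be odd if p is odd and k is even.
- For p = 5 one has tau(5^k) = 5^k u_k, where u is the Lucas sequence with
  parameters 966 and 5^9.  No u_k is divisible by 5, so u_k would be 1 or
  -1, and u_k = 1 modulo 3 for even k.  Finally u_k = 1 with k > 0 even is impossible
  7-adically: the square of the companion matrix is 1 + 7N, and the powers of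
  1 + 7N only return to 1 at the exponent 0 ([lucas_966_neq1]).
- For p <> 5 the congruence tau(p) = p + p^2 modulo 5 shows that 5 divides
  tau(p^k), k even, only if p = 1 modulo 5 and 5 divides k + 1
  ([lucas_mod5]).  Then tau(p^4) divides tau(p^k), so it is a power of 5 up to
  sign; but 5 divides tau(p^4) = P^4 - 3 P^2 Q + Q^2 exactly once.  Hence
  P^4 - 3 P^2 Q + Q^2 = 5 (the sign follows modulo 4), and the points of the
  conic y^2 - 3 y x + x^2 = 5 are pairs of Lucas numbers L_(2j+1), L_(2j+3).
  By Cohn's argument the only even square among these is 4, so P^2 = 4 and
  p^11 = Q is 1 or 11, which is absurd ([lucas_quartic]).

The arithmetic facts about tau that this uses are obtained without analysis,
from the period polynomial r(x, y) = x^2 y^2 (x^2 - y^2)^3 of weight 12.  There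
is an integral function D(h, k) of two integers ([dsym], a Dedekind symbol,
that is, a modular symbol seen as a function on Z^2) which is even, invariant
under (h, k) |-> (h + k, k) and satisfies D(h, k) - D(k, h) = r(h, k).  The
Hecke operator T_p acts on such functions.  Since D composed with any element
of GL_2(Z) differs from D by a form of degree 10, T_p D again has a
reciprocity law whose right hand side is a period polynomial, and there are so
few of these that T_p D = lam D + mu k^10 ([hecke_dsym_eigen]).  Evaluating at
the vectors (b, d), b < d, and summing over d | n gives an integer [musum n],
and 36 sigma_11(n) + 691 [musum n] is 36 times a Hecke eigensequence
([tau36_hecke]).

It remains to see that this eigensequence is tau.  An elementary
identity for sums over the solutions of a x + b y = n in positive integers
([sum_quads_sub]), applied to D on one side and to polynomials on the other,
expresses [musum] by convolutions of divisor functions, and yields the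
classical relations between Eisenstein series.  In terms of generating series
they say that E_4^3 - E_6^2 has coefficients 48 (36 sigma_11 + 691 [musum]) and
that this series solves q G' = E_2 G, as does q prod (1 - q^k)^24 by logarithmic
differentiation.  The solution is unique up to a constant ([tau36E]). *)

(** * The weight 12 period polynomial and its symbol *)

(** This is the even period polynomial attached to the cusp form of weight 12:
antisymmetric, and subject to the three-term relation below. *)
Definition rform (R : pzRingType) (h k : R) : R :=
  h ^+ 2 * k ^+ 2 * (h ^+ 2 - k ^+ 2) ^+ 3.

Lemma rform_anti (R : comPzRingType) (h k : R) : rform h k = - rform k h.
Proof. by rewrite /rform; ring. Qed.

Lemma rform_three_term (R : comPzRingType) (x w : R) :
  rform x w + rform w (x + w) = rform x (x + w).
Proof. by rewrite /rform; ring. Qed.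

Lemma rformxx (R : comPzRingType) (x : R) : rform x x = 0.
Proof. by rewrite /rform; ring. Qed.

Lemma rform0l (R : comPzRingType) (x : R) : rform 0 x = 0.
Proof. by rewrite /rform; ring. Qed.

(** Reciprocity and periodicity leave no choice for the symbol: it has to be the
sum of [rform] along the steps of the Euclidean algorithm.  The argument [fuel]
bounds the number of steps. *)
Fixpoint euclid_sum (fuel h k : nat) : int :=
  if fuel is m.+1 then
    if k == 0%N then 0
    else euclid_sum m k (h %% k) + rform (h %% k)%N%:Z k%:Z
  else 0.

Lemma euclid_sum_fuel m m' h k :
  (k < m)%N -> (k < m')%N -> euclid_sum m h k = euclid_sum m' h k.
Proof.
elim: m m' h k => [|m IH] [|m'] h k //= km km'.
case: eqP => // k0; congr (_ + _); apply: IH.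
- by apply: leq_trans (ltn_pmod _ _) _; lia.
- by apply: leq_trans (ltn_pmod _ _) _; lia.
Qed.

Definition nsym (h k : nat) : int := euclid_sum k.+1 h k.

Lemma nsymE h k : (0 < k)%N ->
  nsym h k = nsym k (h %% k)%N + rform (h %% k)%N%:Z k%:Z.
Proof.
move=> k0; rewrite {1}/nsym /=; case: eqP => [|_]; first by lia.
by congr (_ + _); apply: euclid_sum_fuel => //; exact: ltn_pmod.
Qed.

Lemma nsymn0 h : nsym h 0 = 0.
Proof. by []. Qed.

Lemma nsymDr h k m : nsym (h + m * k) k = nsym h k.
Proof.
case: (posnP k) => [->|k0]; first by rewrite !nsymn0.
by rewrite [LHS]nsymE // [RHS]nsymE // addnC modnMDl.
Qed.

Lemma nsymC h k : nsym h k = nsym k h + rform h%:Z k%:Z.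
Proof.
wlog hk : h k / (h <= k)%N => [H|].
  case: (leqP h k) => hk; first exact: H.
  by rewrite (H k h (ltnW hk)) rform_anti subrK.
case: (posnP k) => [k0|k0].
  have -> : h = 0%N by lia.
  by rewrite k0 rformxx addr0.
case: (ltnP h k) => h1; first by rewrite nsymE // modn_small.
have -> : h = k by lia.
by rewrite rformxx addr0.
Qed.

(** Together with periodicity this gives evenness in [h].  It is the place where
the three-term relation of [rform] enters, and the reason why the Euclidean
recursion is consistent on all of Z^2. *)
Lemma nsym_refl h k : (h <= k)%N -> nsym (k - h) k = nsym h k.
Proof.
move=> hk; set w := (k - h)%N.
have -> : k = (h + w)%N by rewrite /w; lia.
rewrite (nsymC w) (nsymC h (h + w)).
have -> : nsym (h + w) w = nsym h w by rewrite -(nsymDr h w 1) mul1n.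
have -> : nsym (h + w) h = nsym w h by rewrite addnC -(nsymDr w h 1) mul1n.
rewrite (nsymC h w) PoszD -rform_three_term; ring.
Qed.

Definition dsym (h k : int) : int := nsym `|h|%N `|k|%N.

Lemma dsymNl h k : dsym (- h) k = dsym h k.
Proof. by rewrite /dsym abszN. Qed.

Lemma dsymNr h k : dsym h (- k) = dsym h k.
Proof. by rewrite /dsym abszN. Qed.

Lemma dsym0 h : dsym h 0 = 0.
Proof. by []. Qed.

Lemma dsymC h k : dsym h k = dsym k h + rform h k.
Proof.
rewrite /dsym nsymC; congr (_ + _); rewrite /rform.
have sq (z : int) : (`|z|%N%:Z) ^+ 2 = z ^+ 2.
  by rewrite abszE real_normK // num_real.
by rewrite !sq.
Qed.

(** With opposite signs and |h| <= |k|, translation by [k] is the reflection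
[nsym_refl]; otherwise it is periodicity on nat. *)
Lemma dsymD1 h k : dsym (h + k) k = dsym h k.
Proof.
wlog k0 : h k / (0 <= k) => [H|].
  case: (lerP 0 k) => k0; first exact: H.
  by rewrite -dsymNr -[RHS]dsymNr -dsymNl -[RHS]dsymNl opprD H // oppr_ge0 ltW.
case: k k0 => // k _; rewrite /dsym.
case: (lerP 0 h) => h0.
  by case: h h0 => // h _; rewrite -PoszD /= -(nsymDr h k 1) mul1n.
case: (leqP `|h|%N k) => hk.
  have -> : absz (h + k%:Z) = (k - absz h)%N by lia.
  exact: nsym_refl.
by rewrite -(nsymDr (absz (h + k%:Z)) k 1) mul1n; congr nsym; lia.
Qed.

Lemma dsymD h k m : dsym (h + m * k) k = dsym h k.
Proof.
have aux (n : nat) g : dsym (g + n%:Z * k) k = dsym g k.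
  elim: n => [|n IH]; first by rewrite mul0r addr0.
  by rewrite -addn1 PoszD mulrDl mul1r addrA dsymD1.
case: (lerP 0 m) => m0; first by case: m m0.
by rewrite -(aux `|m|%N (h + m * k)); congr dsym; rewrite abszE ltr0_norm //; ring.
Qed.

(** * Binary forms and the cocycle of the symbol *)

(** Forms are handled as functions with unspecified coefficients, since all that
is used of a cocycle value is that it has eleven coefficients. *)
Definition is_form (m : nat) (F : int -> int -> int) :=
  exists c : nat -> int, forall h k, F h k = \sum_(i < m.+1) c i * h ^+ i * k ^+ (m - i).

Lemma is_form_const (c : int) : is_form 0 (fun _ _ => c).
Proof. by exists (fun=> c) => h k; rewrite big_ord1 !expr0 !mulr1. Qed.

Lemma is_form_lin m F (a b : int) :
  is_form m F -> is_form m.+1 (fun h k => (a * h + b * k) * F h k).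
Proof.
case=> c E; exists (fun i => a * (if i is j.+1 then c j else 0)
   + b * (if (i < m.+1)%N then c i else 0)) => h k.
rewrite E.
have -> : \sum_(i < m.+2) (a * (if (i : nat) is j.+1 then c j else 0)
     + b * (if (i < m.+1)%N then c i else 0)) * h ^+ i * k ^+ (m.+1 - i) =
   \sum_(i < m.+2) (a * (if (i : nat) is j.+1 then c j else 0)) * h ^+ i * k ^+ (m.+1 - i)
   + \sum_(i < m.+2) (b * (if (i < m.+1)%N then c i else 0)) * h ^+ i * k ^+ (m.+1 - i).
  by rewrite -big_split /=; apply: eq_bigr => i _; rewrite !mulrDl.
rewrite mulrDl; congr (_ + _).
  rewrite [RHS]big_ord_recl /= mulr0 !mul0r add0r mulr_sumr; apply: eq_bigr => i _.
  rewrite /bump /= add1n subSS exprS; ring.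
rewrite [RHS]big_ord_recr /= ltnn /= mulr0 !mul0r addr0 mulr_sumr; apply: eq_bigr => i _.
rewrite ltn_ord subSn; last by rewrite -ltnS.
by rewrite exprS; ring.
Qed.

Lemma is_form_ext m F G : (forall h k, F h k = G h k) -> is_form m F -> is_form m G.
Proof. by move=> E [c H]; exists c => h k; rewrite -E. Qed.

Lemma is_formD m F G : is_form m F -> is_form m G ->
  is_form m (fun h k => F h k + G h k).
Proof.
move=> [c Hc] [d Hd]; exists (fun i => c i + d i) => h k.
by rewrite Hc Hd -big_split /=; apply: eq_bigr => i _; rewrite !mulrDl.
Qed.

Lemma is_form0 m : is_form m (fun _ _ => 0).
Proof. by exists (fun=> 0) => h k; rewrite big1 // => i _; rewrite !mul0r. Qed.

Lemma is_form_sum m I (s : seq I) (P : pred I) (F : I -> int -> int -> int) :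
  (forall i, P i -> is_form m (F i)) ->
  is_form m (fun h k => \sum_(i <- s | P i) F i h k).
Proof.
move=> H; elim: s => [|i s IH].
  by apply: is_form_ext (is_form0 m) => h k; rewrite big_nil.
case Pi: (P i).
  apply: is_form_ext (is_formD (H i Pi) IH) => h k.
  by rewrite big_cons Pi.
by apply: is_form_ext IH => h k; rewrite big_cons Pi.
Qed.

(** The polynomial [rform] is a product of ten linear forms. *)
Lemma is_form_rform a b c d :
  is_form 10 (fun h k => rform (a * h + b * k) (c * h + d * k)).
Proof.
have H0 := is_form_const 1.
have H := is_form_lin a b (is_form_lin a b (is_form_lin c d (is_form_lin c d H0))).
have {}H := is_form_lin (a - c) (b - d) (is_form_lin (a - c) (b - d)
   (is_form_lin (a - c) (b - d) H)).
have {}H := is_form_lin (a + c) (b + d) (is_form_lin (a + c) (b + d)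
   (is_form_lin (a + c) (b + d) H)).
by apply: is_form_ext H => h k; rewrite /rform; ring.
Qed.

(** Euclidean division on the first column reduces a matrix of determinant 1 or
-1 to a triangular one, under which [dsym] is invariant; each division step
costs one application of the reciprocity law, hence one form of degree 10. *)
Lemma dsym_cocycle (a b c d : int) : absz (a * d - b * c)%R = 1%N ->
  is_form 10 (fun h k => dsym (a * h + b * k) (c * h + d * k) - dsym h k).
Proof.
have [n] := ubnP `|c|%N; elim: n a b c d => // n IH a b c d cn det.
case: (eqVneq c 0) => [c0|c0].
  move: det; rewrite c0 mulr0 subr0 abszM => /eqP; rewrite muln_eq1 => /andP [a1 d1].
  apply: is_form_ext (is_form0 10) => h k; rewrite mul0r add0r.
  have {}a1 : a = 1 \/ a = -1 by lia.
  have {}d1 : d = 1 \/ d = -1 by lia.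
  suff E e : dsym (h + e * k) k = dsym h k.
    case: a1 => ->; case: d1 => ->; rewrite ?mulN1r ?mul1r ?dsymNr ?E ?subrr //.
      by rewrite -dsymNl opprD opprK -mulNr E subrr.
    by rewrite -dsymNl opprD opprK -mulNr E subrr.
  exact: dsymD.
pose q := (a %/ c)%Z; pose a' := (a %% c)%Z.
have Ea : a = q * c + a' by exact: divz_eq.
have a'c : (`|a'| < `|c|)%N.
  have := ltz_mod a c0; have := modz_ge0 a c0; rewrite -/a'; lia.
pose b' := b - q * d.
have detE : absz (c * b' - d * a')%R = 1%N.
  by rewrite -det -abszN /b' Ea; congr absz; ring.
have {}IH := IH c d a' b' (leq_trans a'c cn) detE.
apply: is_form_ext (is_formD IH (is_form_rform a' b' c d)) => h k /=.
have -> : a * h + b * k = (a' * h + b' * k) + q * (c * h + d * k).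
  by rewrite /b' Ea; ring.
by rewrite dsymD (dsymC (a' * h + b' * k)) addrAC.
Qed.

Lemma is_formN m F : is_form m F -> is_form m (fun h k => - F h k).
Proof.
case=> c E; exists (fun i => - c i) => h k.
by rewrite E -sumrN; apply: eq_bigr => i _; rewrite !mulNr.
Qed.

Lemma is_form_pow m n F (a b : int) :
  is_form m F -> is_form (n + m) (fun h k => (a * h + b * k) ^+ n * F h k).
Proof.
move=> H; elim: n => [|n IH].
  by apply: is_form_ext H => h k; rewrite expr0 mul1r.
by apply: is_form_ext (is_form_lin a b IH) => h k; rewrite exprS mulrA.
Qed.

Lemma is_form_comp m F (a b c d : int) :
  is_form m F -> is_form m (fun h k => F (a * h + b * k) (c * h + d * k)).
Proof.
case=> u E.
have H : is_form m (fun h k => \sum_(i < m.+1)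
    u i * (a * h + b * k) ^+ i * (c * h + d * k) ^+ (m - i)).
  apply: is_form_sum => i _.
  have := is_form_pow i a b (is_form_pow (m - i) c d (is_form_const (u i))).
  rewrite addn0 subnKC -1?ltnS // => Hi.
  by apply: is_form_ext Hi => h k; ring.
by apply: is_form_ext H => h k; rewrite E.
Qed.

(** * Hecke operators on the symbol *)

(** The Hecke operator T_p for p prime: the matrices (p, 0; 0, 1) and (1, b; 0, p)
represent the sublattices of index p in Z^2. *)
Definition heckeop (p : nat) (F : int -> int -> int) (h k : int) : int :=
  F (p%:Z * h) k + \sum_(b < p) F (h + b%:Z * k) (p%:Z * k).

Lemma sum_shift (g : int -> int) p : (forall b, g (b + p%:Z) = g b) ->
  \sum_(b < p) g (b%:Z + 1) = \sum_(b < p) g b%:Z.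
Proof.
case: p => [|p] H; first by rewrite !big_ord0.
rewrite big_ord_recr [RHS]big_ord_recl [RHS]addrC; congr (_ + _) => /=; last first.
  by rewrite -[in RHS]H; congr g; lia.
by apply: eq_bigr => i _; rewrite /bump add1n -PoszD addn1.
Qed.

Lemma sum_opp (g : int -> int) p : (forall b, g (b + p%:Z) = g b) ->
  \sum_(b < p) g (- b%:Z) = \sum_(b < p) g b%:Z.
Proof.
move=> H; rewrite -(sum_shift H) (reindex_inj rev_ord_inj) /=.
apply: eq_bigr => i _; rewrite -H; congr g.
have := ltn_ord i; lia.
Qed.

Lemma dsym_shift p (h k : int) b :
  dsym (h + (b + p%:Z) * k) (p%:Z * k) = dsym (h + b * k) (p%:Z * k).
Proof. by rewrite mulrDl addrA dsymD1. Qed.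

Lemma hecke_dsymD1 p h k : heckeop p dsym (h + k) k = heckeop p dsym h k.
Proof.
rewrite /heckeop mulrDr dsymD; congr (_ + _).
rewrite -(@sum_shift (fun b => dsym (h + b * k) (p%:Z * k))).
  by apply: eq_bigr => b _; congr dsym; ring.
by move=> b; rewrite dsym_shift.
Qed.

Lemma hecke_dsymN p h k : heckeop p dsym (- h) k = heckeop p dsym h k.
Proof.
rewrite /heckeop mulrN dsymNl; congr (_ + _).
rewrite -(@sum_opp (fun b => dsym (h + b * k) (p%:Z * k))).
  by apply: eq_bigr => b _; rewrite -dsymNl; congr dsym; ring.
by move=> b; rewrite dsym_shift.
Qed.

Lemma Zp_mulV p (b : 'I_p.+2) : prime p.+2 -> b != 0 ->
  exists c : int, (b%:Z * (b^-1 : 'I_p.+2)%:Z) = 1 + c * p.+2%:Z.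
Proof.
move=> pp b0.
have ub : b \is a GRing.unit.
  suff : ((b : nat)%:R : 'Z_(p.+2)) \is a GRing.unit by rewrite natr_Zp.
  rewrite unitZpE // prime_coprime //.
  apply/negP => /dvdn_leq H; have := ltn_ord b.
  have b1 : (0 < b)%N by rewrite lt0n.
  by rewrite ltnNge H.
have := congr1 val (mulrV ub) => /=.
rewrite (@modn_small 1 p.+2) // => E.
exists ((b * (b^-1)%R) %/ p.+2)%N%:Z.
by rewrite -!PoszM {1}(divn_eq (b * (b^-1)%R) p.+2) E PoszD addrC.
Qed.

(** Exchanging [h] and [k] permutes the sublattices of index p: for b nonzero
modulo p, the class b is sent to its inverse, up to an element of GL_2(Z), so
the two terms differ by a cocycle value.  The two remaining lattices are
exchanged and contribute values of [rform]. *)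
Lemma hecke_dsym_form p : prime p ->
  is_form 10 (fun h k => heckeop p dsym h k - heckeop p dsym k h).
Proof.
case: p => [|[|p]] // pp.
have Hsum : is_form 10 (fun h k => \sum_(b < p.+2 | b != 0)
    (dsym (h + b%:Z * k) (p.+2%:Z * k) - dsym (k + (b^-1)%R%:Z * h) (p.+2%:Z * h))).
  apply: is_form_sum => b b0.
  (* With b * b' = 1 + c * p, the matrix (b', -c; p, -b) maps
     (h + b k, p k) to (k + b' h, p h). *)
  have [c Ec] := Zp_mulV pp b0.
  set b' := (b^-1)%R; rewrite -/b' in Ec.
  have det : absz (b'%:Z * (- b%:Z) - (- c) * p.+2%:Z)%R = 1%N.
    by rewrite mulrN (mulrC b'%:Z) Ec mulNr opprK opprD subrK.
  have := is_formN (is_form_comp 1 b%:Z 0 p.+2%:Z (dsym_cocycle det)).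
  apply: is_form_ext => h k.
  rewrite mul1r mul0r add0r opprB; congr (_ - dsym _ _); last by ring.
  have -> : - c * (p.+2%:Z * k) = (1 - (b%:Z * b'%:Z)) * k by rewrite Ec; ring.
  by ring.
apply: is_form_ext (is_formD Hsum (is_formD (is_form_rform p.+2%:Z 0 0 1)
  (is_form_rform 1 0 0 p.+2%:Z))) => h k.
rewrite !mul0r !mul1r !addr0 !add0r /heckeop.
have -> : \sum_(b < p.+2) dsym (k + b%:Z * h) (p.+2%:Z * h) =
          \sum_(b < p.+2) dsym (k + (b^-1)%R%:Z * h) (p.+2%:Z * h).
  by rewrite (reindex_inj invr_inj).
have split0 (G : 'I_p.+2 -> int) : \sum_b G b = G 0 + \sum_(b | b != 0) G b.
  by rewrite (bigD1 0).
rewrite !split0.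
rewrite sumrB invr0 !mul0r !addr0.
rewrite (dsymC (p.+2%:Z * h)) (dsymC h (p.+2%:Z * k)).
ring.
Qed.

(** The even period polynomials of weight 12 form a space of dimension 2.  The
relations at a few integral points already determine the coefficients. *)
Lemma even_period_form F :
  is_form 10 F -> (forall h k, F (- h) k = F h k) -> (forall h k, F h k = - F k h) ->
  (forall x w, F x w + F w (x + w) = F x (x + w)) ->
  exists lam mu : int, forall h k, F h k = lam * rform h k + mu * (k ^+ 10 - h ^+ 10).
Proof.
case=> c E even anti three.
have {}E h k : F h k = c 0%N * k ^+ 10 + c 1%N * h * k ^+ 9 + c 2%N * h ^+ 2 * k ^+ 8
  + c 3%N * h ^+ 3 * k ^+ 7 + c 4%N * h ^+ 4 * k ^+ 6 + c 5%N * h ^+ 5 * k ^+ 5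
  + c 6%N * h ^+ 6 * k ^+ 4 + c 7%N * h ^+ 7 * k ^+ 3 + c 8%N * h ^+ 8 * k ^+ 2
  + c 9%N * h ^+ 9 * k + c 10%N * h ^+ 10.
  by rewrite E !big_ord_recr big_ord0 /=; ring.
have [c1 c3 c5 c7 c9] : [/\ c 1%N = 0, c 3%N = 0, c 5%N = 0, c 7%N = 0 & c 9%N = 0].
  (* Evenness at (1, 1), ..., (1, 5): a Vandermonde system for the odd
     coefficients. *)
  have := even 1 1; have := even 1 2; have := even 1 3; have := even 1 4; have := even 1 5.
  rewrite !E.
  have := anti 1 1; rewrite !E; split; lra.
(* In [rform] the coefficient of h^8 k^2 is 1, and k^10 does not occur. *)
exists (c 8%N), (c 0%N) => h k.
have [c2 c4 c6 c10] : [/\ c 2%N = - c 8%N, c 4%N = 3 * c 8%N, c 6%N = -3 * c 8%N & c 10%N = - c 0%N].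
  have := anti 1 2; have := anti 1 3; have := anti 1 4; have := three 1 2.
  rewrite !E c1 c3 c5 c7 c9; split; lra.
by rewrite E c1 c2 c3 c4 c5 c6 c7 c9 c10 /rform; ring.
Qed.

(** A function that is periodic and symmetric is constant along the Euclidean
algorithm, so it is determined by its values at (h, 0). *)
Lemma sym_periodic_eq0 (G : int -> int -> int) :
  (forall h k, G (h + k) k = G h k) -> (forall h k, G h k = G k h) ->
  (forall h, G h 0 = 0) -> forall h k, G h k = 0.
Proof.
move=> per sym G0.
have perN (n : nat) g k : G (g + n%:Z * k) k = G g k.
  elim: n => [|n IH]; first by rewrite mul0r addr0.
  by rewrite -addn1 PoszD mulrDl mul1r addrA per.
have {}per m g k : G (g + m * k) k = G g k.
  case: (lerP 0 m) => m0; first by case: m m0.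
  rewrite -(perN `|m|%N (g + m * k)); congr (G _ k).
  by rewrite abszE ltr0_norm //; ring.
move=> h k; have [n] := ubnP `|k|%N; elim: n h k => // n IH h k kn.
case: (eqVneq k 0) => [->|k0]; first exact: G0.
rewrite (divz_eq h k) addrC per sym; apply: IH.
by have := ltz_mod h k0; have := modz_ge0 h k0; lia.
Qed.

(** Both sides solve the same recursion: their difference has trivial
reciprocity. *)
Lemma dsym_scale (p h k : int) : dsym (p * h) (p * k) = p ^+ 10 * dsym h k.
Proof.
apply/eqP; rewrite -subr_eq0; apply/eqP; move: h k.
apply: (sym_periodic_eq0 (G := fun h k => dsym (p * h) (p * k) - p ^+ 10 * dsym h k)).
- by move=> h k; rewrite mulrDr !dsymD1.
- by move=> h k; rewrite (dsymC (p * h)) (dsymC h) /rform; ring.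
- by move=> h; rewrite mulr0 !dsym0 mulr0 subrr.
Qed.

Lemma hecke_dsymNr p h k : heckeop p dsym h (- k) = heckeop p dsym h k.
Proof.
rewrite -hecke_dsymN /heckeop mulrN dsymNl dsymNr; congr (_ + _).
by apply: eq_bigr => b _; rewrite mulrN mulrN dsymNr -dsymNl; congr dsym; ring.
Qed.

Definition dsum (d : nat) : int := \sum_(b < d) dsym b d.

(** The reciprocity of T_p [dsym] is a period polynomial, so it agrees with that
of lam * [dsym] + mu * k^10 for some lam and mu; by [sym_periodic_eq0] the
functions agree.  The value of mu is read off at (0, 1). *)
Lemma hecke_dsym_eigen p : prime p -> exists lam : int, forall h k,
  heckeop p dsym h k = lam * dsym h k + dsum p * k ^+ 10.
Proof.
move=> pp; set F := heckeop p dsym.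
have F0 h : F h 0 = 0.
  by rewrite /F /heckeop dsym0 add0r big1 // => b _; rewrite !mulr0 dsym0.
have per := @hecke_dsymD1 p.
have [|||lam [mu E]] := even_period_form (hecke_dsym_form pp).
- by move=> h k; rewrite hecke_dsymN hecke_dsymNr.
- by move=> h k; rewrite opprB.
- move=> x w; rewrite per.
  have -> : heckeop p dsym (x + w) x = heckeop p dsym w x by rewrite addrC per.
  have -> : heckeop p dsym w (x + w) = heckeop p dsym x (x + w).
    by rewrite -[RHS]hecke_dsymN -[RHS]per addrA addNr add0r.
  by ring.
have {}E h k : F h k = lam * dsym h k + mu * k ^+ 10.
  apply/eqP; rewrite -subr_eq0; apply/eqP; move: h k.
  apply: (sym_periodic_eq0 (G := fun h k => F h k - (lam * dsym h k + mu * k ^+ 10))).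
  - by move=> h k; rewrite /F per dsymD1.
  - move=> h k; have := E h k; rewrite -/F => /eqP; rewrite subr_eq => /eqP ->.
    by rewrite (dsymC h k); ring.
  - by move=> h; rewrite F0 dsym0 expr0n /= mulr0 mulr0 addr0.
exists lam => h k; rewrite -/F E; congr (_ + _ * _).
have := E 0 1; rewrite expr1n mulr1 dsymC dsym0 /F /heckeop mulr0 (dsymC 0).
rewrite dsym0 !rform0l !(add0r, addr0) mulr0 add0r => <-.
by apply: eq_bigr => b _; rewrite add0r !mulr1.
Qed.

Lemma sum_blocks (V : nmodType) (g : nat -> V) p d :
  \sum_(c < p * d) g c = \sum_(j < p) \sum_(b < d) g (b + j * d)%N.
Proof.
elim: p => [|p IH]; first by rewrite mul0n !big_ord0.
rewrite big_ord_recr /= -IH mulSnr big_split_ord /=.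
by congr (_ + _); apply: eq_bigr => i _; rewrite addnC.
Qed.

(** The eigenvalue equation summed over the vectors (b, d) with b < d.  The map
b |-> p * b permutes the residues modulo d when p does not divide d, and is
p-to-one onto the multiples of p otherwise. *)
Lemma dsum_hecke p lam : prime p -> (forall h k,
  heckeop p dsym h k = lam * dsym h k + dsum p * k ^+ 10) ->
  forall d, (0 < d)%N ->
  dsum (p * d) + (if (p %| d)%N then p%:Z ^+ 11 * dsum (d %/ p)%N else dsum d)
   = lam * dsum d + dsum p * d%:Z ^+ 11.
Proof.
move=> pp E d d0.
have <- : \sum_(b < d) heckeop p dsym b%:Z d%:Z
        = lam * dsum d + dsum p * d%:Z ^+ 11.
  under eq_bigr do rewrite E.
  rewrite big_split /= -mulr_sumr sumr_const card_ord -/(dsum d).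
  by rewrite -mulr_natr natz; ring.
rewrite /heckeop big_split /= [RHS]addrC; congr (_ + _).
  rewrite /dsum (sum_blocks (fun c => dsym c%:Z (p * d)%N%:Z)) exchange_big /=; apply: eq_bigr => b _.
  by apply: eq_bigr => j _; rewrite PoszD !PoszM.
case: ifP => pd.
  have /dvdnP[e Ed] := pd; have p0 := prime_gt0 pp.
  rewrite Ed mulnK // mulnC.
  under [RHS]eq_bigr do rewrite PoszM dsym_scale.
  rewrite -mulr_sumr exprSr -mulrA; congr (_ * _).
  rewrite (sum_blocks (fun c => dsym c%:Z e%:Z)) -/(dsum e) mulrC.
  under [RHS]eq_bigr => j _.
    under eq_bigr do rewrite PoszD PoszM dsymD.
    over.
  by rewrite sumr_const card_ord -mulr_natr natz.
case: d d0 pd {E} => // d _ pd.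
have inj : injective (fun b : 'I_d.+1 => inord (p * b %% d.+1) : 'I_d.+1).
  move=> a b /(congr1 val) /=; rewrite !inordK ?ltn_pmod // => /eqP ab.
  apply/val_inj => /=; wlog le_ab : a b ab / (a <= b)%N => [H|].
    case: (leqP a b) => h; first exact: H.
    by apply/esym/H => //; [rewrite eq_sym | exact: ltnW].
  move: ab; rewrite eq_sym eqn_mod_dvd ?leq_mul2l ?le_ab ?orbT //.
  rewrite -mulnBr Gauss_dvdr; last by rewrite coprime_sym prime_coprime // pd.
  case: (posnP (b - a)) => [|ba /dvdn_leq]; first by lia.
  by have := ltn_ord b; lia.
rewrite /dsum (reindex_inj inj) /=; apply: eq_bigr => b _.
rewrite inordK ?ltn_pmod // -(dsymD _ _ ((p * b) %/ d.+1)%N%:Z) -PoszM -PoszM -PoszD.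
by rewrite addnC -divn_eq.
Qed.

(** * Divisor sums and the Hecke relation *)

Definition sigma (k n : nat) : nat := \sum_(d <- divisors n) d ^ k.

Lemma sum_divisors_mul (V : nmodType) (A : nat -> V) p n : prime p -> (0 < n)%N ->
  \sum_(d <- divisors (p * n)) A d
  = \sum_(d <- divisors n) A (p * d)%N + \sum_(d <- divisors n | ~~ (p %| d)%N) A d.
Proof.
move=> pp n0; have p0 := prime_gt0 pp.
rewrite -[X in _ + X]big_filter -(big_map (muln p) xpredT A) -big_cat.
apply: perm_big; apply: uniq_perm.
- exact: divisors_uniq.
- rewrite cat_uniq map_inj_uniq ?divisors_uniq ?filter_uniq ?divisors_uniq //; last first.
    by move=> a b /eqP; rewrite eqn_pmul2l // => /eqP.
  rewrite andbT /=; apply/hasPn => d; rewrite mem_filter => /andP[pd _].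
  by apply/mapP => -[e _ Ed]; rewrite Ed dvdn_mulr in pd.
move=> d; rewrite mem_cat mem_filter -!dvdn_divisors ?muln_gt0 ?p0 //.
case: (boolP (p %| d)%N) => [/dvdnP[e ->]|pd] /=.
  rewrite orbF mulnC dvdn_pmul2l //; apply/idP/mapP => [en|[f]].
    by exists e => //; rewrite -dvdn_divisors.
  by rewrite -dvdn_divisors // => fn /eqP; rewrite eqn_pmul2l // => /eqP ->.
rewrite Gauss_dvdr; last by rewrite coprime_sym prime_coprime.
case: (boolP (d %| n)%N); rewrite ?orbT // orbF => _.
by apply/esym/negbTE/mapP => -[e _ Ed]; rewrite Ed dvdn_mulr in pd.
Qed.

Lemma sum_divisors_div (V : nmodType) (A : nat -> V) p n : prime p -> (0 < n)%N ->
  \sum_(d <- divisors n | (p %| d)%N) A (d %/ p)%N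
  = if (p %| n)%N then \sum_(d <- divisors (n %/ p)) A d else 0.
Proof.
move=> pp n0; have p0 := prime_gt0 pp.
case: ifP => pn; last first.
  rewrite big_seq_cond big1 // => d; rewrite -dvdn_divisors // => /andP[dn pd].
  by rewrite (dvdn_trans pd dn) in pn.
have /dvdnP[m Em] := pn; rewrite Em mulnK // mulnC.
have m0 : (0 < m)%N by move: n0; rewrite Em muln_gt0 => /andP[].
rewrite big_mkcond sum_divisors_mul // [X in _ + X]big1 ?addr0; last first.
  by move=> d /negbTE ->.
by apply: eq_bigr => d _; rewrite dvdn_mulr // mulKn.
Qed.

(** The divisors of p * n are the p * d and the divisors of n prime to p; those
of n / p are the d / p with p | d.  Here d runs over the divisors of n. *)
Lemma divisor_sum_hecke (A X : nat -> int) (C : int) p n : prime p -> (0 < n)%N ->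
  (forall d, (0 < d)%N ->
    A (p * d)%N + (if (p %| d)%N then C * A (d %/ p)%N else A d) = X d) ->
  \sum_(d <- divisors (p * n)) A d
   + C * (if (p %| n)%N then \sum_(d <- divisors (n %/ p)) A d else 0)
  = \sum_(d <- divisors n) X d.
Proof.
move=> pp n0 H; rewrite sum_divisors_mul // -sum_divisors_div // mulr_sumr.
transitivity (\sum_(d <- divisors n)
    (A (p * d)%N + (if (p %| d)%N then C * A (d %/ p)%N else A d))); last first.
  apply: eq_big_seq.
  move=> d; rewrite -dvdn_divisors // => dn.
  by rewrite H ?(dvdn_gt0 n0 dn).
rewrite big_split /= -addrA; congr (_ + _).
rewrite [RHS](bigID (fun d => p %| d)%N) /= addrC; congr (_ + _).
  by apply: eq_bigr => d ->.
by apply: eq_bigr => d /negbTE ->.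
Qed.

(** The value at (0, 1) of the n-th Hecke operator applied to [dsym]. *)
Definition musum (n : nat) : int := \sum_(d <- divisors n) dsum d.

(** On the span of sigma_11 and [musum] the Hecke operators are triangular;
besides sigma_11 the common eigenvector is sigma_11 + (691 / 36) [musum], and the
factor 36 keeps it integral. *)
Definition tau36 (n : nat) : int := 36 * (sigma 11 n)%:Z + 691 * musum n.

Lemma sigmaE k n : (sigma k n)%:Z = \sum_(d <- divisors n) d%:Z ^+ k.
Proof.
rewrite /sigma (big_morph Posz PoszD (erefl _)).
by apply: eq_bigr => d _; rewrite -natz natrX natz.
Qed.

Lemma sigma_hecke k p n : prime p -> (0 < n)%N ->
  (sigma k (p * n))%:Z + p%:Z ^+ k * (if (p %| n)%N then (sigma k (n %/ p))%:Z else 0)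
  = (1 + p%:Z ^+ k) * (sigma k n)%:Z.
Proof.
move=> pp n0; rewrite !sigmaE mulr_sumr.
apply: (divisor_sum_hecke (A := fun d => d%:Z ^+ k)) => // d d0.
rewrite PoszM exprMn mulrDl mul1r addrC; congr (_ + _).
case: ifP => // /dvdnP[e ->]; rewrite mulnK ?prime_gt0 //.
by rewrite PoszM exprMn mulrC.
Qed.

Lemma musum_hecke p : prime p -> exists lam : int, 
  (forall h k, heckeop p dsym h k = lam * dsym h k + dsum p * k ^+ 10) /\
  forall n, (0 < n)%N ->
  musum (p * n) + p%:Z ^+ 11 * (if (p %| n)%N then musum (n %/ p) else 0)
  = lam * musum n + dsum p * (sigma 11 n)%:Z.
Proof.
move=> pp; have [lam E] := hecke_dsym_eigen pp; exists lam; split => // n n0.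
rewrite sigmaE !mulr_sumr -big_split.
by apply: divisor_sum_hecke => // d d0; exact: dsum_hecke.
Qed.

Lemma dsum1 : dsum 1 = 0.
Proof. by rewrite /dsum big_ord1. Qed.

Lemma dsym1 h : dsym h 1 = 0.
Proof. by rewrite -[h]add0r -[h in 0 + h]mulr1 dsymD dsymC dsym0 rform0l. Qed.

Lemma dsym1n k : dsym 1 k = rform 1 k.
Proof. by rewrite dsymC dsym1 add0r. Qed.

Lemma dsum2 : dsum 2 = -108.
Proof.
rewrite /dsum !big_ord_recl big_ord0 /= /bump /= addr0.
rewrite dsym1n dsymC dsym0 rform0l !add0r.
by rewrite /rform; ring.
Qed.

Lemma divisors_prime p : prime p -> divisors p = [:: 1%N; p].
Proof.
move=> pp; apply: (sorted_eq leq_trans anti_leq).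
- exact: sorted_divisors.
- by rewrite /= andbT prime_gt0.
apply: uniq_perm; rewrite ?divisors_uniq //= ?andbT ?inE.
  by rewrite neq_ltn prime_gt1.
move=> d; rewrite -dvdn_divisors ?prime_gt0 // !inE.
apply/idP/idP => [dp|/orP[]/eqP -> //].
by case/primeP: pp => _ /(_ _ dp).
Qed.

Lemma musum_prime p : prime p -> musum p = dsum p.
Proof.
by move=> pp; rewrite /musum divisors_prime // big_cons big_seq1 dsum1 add0r.
Qed.

Lemma sigma_prime k p : prime p -> (sigma k p)%:Z = 1 + p%:Z ^+ k.
Proof.
by move=> pp; rewrite sigmaE divisors_prime // big_cons big_seq1 expr1n.
Qed.

Lemma sigma1 k : sigma k 1 = 1%N.
Proof. by rewrite /sigma big_seq1 exp1n. Qed.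

Lemma hecke2_eigenvalue (lam : int) :
  (forall h k, heckeop 2 dsym h k = lam * dsym h k + dsum 2 * k ^+ 10) -> lam = -24.
Proof.
move/(_ 1 2); rewrite dsum2 /heckeop !big_ord_recl big_ord0 addr0 /= /bump /=.
have -> : dsym (2 * 1) 2 = 0.
  by rewrite (_ : 2 * 1 = 0 + 1 * 2) // dsymD dsymC dsym0 rform0l.
have -> : dsym (1 + 0 * 2) (2 * 2) = rform 1 4 by rewrite mul0r addr0 dsym1n.
have -> : dsym (1 + 1 * 2) (2 * 2) = rform 1 3 + rform 3 4.
  by rewrite dsymC (_ : 2 * 2 = 1 + 1 * 3) // dsymD dsym1n.
by rewrite dsym1n /rform => E; lra.
Qed.

(** The Hecke relation of p at n = 2 and that of 2 at n = p both compute
musum(2 p).  Equating them expresses the eigenvalue at p through the eigenvalue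
-24 at 2, since musum(2) is not 0. *)
Lemma hecke_eigenvalue p (lam : int) : prime p ->
  (forall h k, heckeop p dsym h k = lam * dsym h k + dsum p * k ^+ 10) ->
  (forall n, (0 < n)%N ->
  musum (p * n) + p%:Z ^+ 11 * (if (p %| n)%N then musum (n %/ p) else 0)
  = lam * musum n + dsum p * (sigma 11 n)%:Z) ->
  36 * lam = tau36 p.
Proof.
move=> pp E M; rewrite /tau36 musum_prime // sigma_prime //.
have p2 : prime 2 by [].
have [lam2 [E2 M2]] := musum_hecke p2.
have l2 := hecke2_eigenvalue E2.
case: (eqVneq p 2%N) => [pe|pn].
  by move: E; rewrite pe => /hecke2_eigenvalue ->; rewrite dsum2.
have d1 : (2 %| p)%N = false.
  by rewrite dvdn_prime2 //; apply/negbTE; rewrite eq_sym.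
have d2 : (p %| 2)%N = false by rewrite dvdn_prime2 //; apply/negbTE.
have := M 2%N isT; have := M2 p (prime_gt0 pp).
rewrite d1 d2 !mulr0 !addr0 mulnC => ->.
rewrite !musum_prime // !sigma_prime // dsum2 l2.
have -> : 2%N%:Z ^+ 11 = 2048 by [].
lra.
Qed.

(** By [sigma_hecke] and [musum_hecke], T_p acts on the pair
(sigma_11, [musum]) by a triangular matrix; [tau36] is the combination on which
it acts by the scalar lam of [hecke_eigenvalue]. *)
Theorem tau36_hecke p n : prime p -> (0 < n)%N ->
  36 * (tau36 (p * n) + p%:Z ^+ 11 * (if (p %| n)%N then tau36 (n %/ p) else 0))
  = tau36 p * tau36 n.
Proof.
move=> pp n0; have [lam [E M]] := musum_hecke pp.
have L := hecke_eigenvalue pp E M.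
have {}M := M n n0; have S := sigma_hecke 11 pp n0.
rewrite -L; move: L; rewrite /tau36 musum_prime // sigma_prime // => L.
have -> : (if (p %| n)%N then 36 * (sigma 11 (n %/ p))%:Z + 691 * musum (n %/ p) else 0)
  = 36 * (if (p %| n)%N then (sigma 11 (n %/ p))%:Z else 0)
  + 691 * (if (p %| n)%N then musum (n %/ p) else 0).
  by case: ifP => // _; rewrite !mulr0.
set q := p%:Z ^+ 11 in S M L *.
set i1 := (if _ then _ else _) in S *; set i2 := (if _ then _ else _) in M *.
have -> : (36 * (sigma 11 (p * n))%:Z + 691 * musum (p * n) + q * (36 * i1 + 691 * i2))
  = 36 * ((sigma 11 (p * n))%:Z + q * i1) + 691 * (musum (p * n) + q * i2) by ring.
rewrite S M; set x := (sigma 11 n)%:Z; set y := musum n.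
have -> : 36 * (36 * ((1 + q) * x) + 691 * (lam * y + dsum p * x))
  = 36 * x * (36 * (1 + q) + 691 * dsum p) + 36 * lam * (691 * y) by ring.
by rewrite -L; ring.
Qed.

(** * Sums over the solutions of a x + b y = n *)

(** A pair (a, x) stands for the factorization m = a * x, and an entry
((a, x), (b, y)) of [quads] for the equation a * x + b * y = n. *)
Definition divpairs (m : nat) : seq (nat * nat) := [seq ((m %/ d)%N, d) | d <- divisors m].

Lemma mem_divpairs m a x : (0 < m)%N -> ((a, x) \in divpairs m) = (a * x == m)%N.
Proof.
move=> m0; apply/mapP/eqP => [[d] | E].
  by rewrite -dvdn_divisors // => dm [-> ->]; rewrite divnK.
have x0 : (0 < x)%N by move: m0; rewrite -E muln_gt0 => /andP[].
by exists x; rewrite -?dvdn_divisors // -E ?dvdn_mull // mulnK.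
Qed.

Definition quads (n : nat) : seq ((nat * nat) * (nat * nat)) :=
  [seq w | m <- iota 1 n.-1, w <- [seq (u, v) | u <- divpairs m, v <- divpairs (n - m)]].

Lemma mem_quads n a x b y : (((a, x), (b, y)) \in quads n)
  = [&& 0 < a, 0 < x, 0 < b, 0 < y & a * x + b * y == n]%N.
Proof.
apply/allpairsPdep/idP => [[m [w [mn wm /esym Ew]]]|].
  move: wm; rewrite {}Ew => /allpairsPdep [[a' x'] [[b' y'] [ax bY [-> -> -> ->]]]].
  move: mn; rewrite mem_iota => /andP[m0 mn].
  have nm0 : (0 < n - m)%N by lia.
  move: ax bY; rewrite !mem_divpairs // => /eqP ax /eqP bY.
  have : (0 < a' * x')%N by rewrite ax.
  have : (0 < b' * y')%N by rewrite bY.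
  rewrite !muln_gt0 ax bY => /andP[-> ->] /andP[-> ->] /=; lia.
case/and5P => a0 x0 b0 y0 /eqP E.
have ax0 : (0 < a * x)%N by rewrite muln_gt0 a0.
have by0 : (0 < b * y)%N by rewrite muln_gt0 b0.
exists (a * x)%N, ((a, x), (b, y)); split => //; first by rewrite mem_iota; lia.
apply/allpairsPdep; exists (a, x), (b, y); split => //.
  by rewrite mem_divpairs.
by rewrite mem_divpairs; lia.
Qed.

Lemma uniq_divpairs m : uniq (divpairs m).
Proof.
by rewrite map_inj_uniq ?divisors_uniq // => d e [].
Qed.

Lemma uniq_quads n : uniq (quads n).
Proof.
apply: allpairs_uniq_dep => [|m _|]; first exact: iota_uniq.
  apply: allpairs_uniq; rewrite ?uniq_divpairs //.
  by move=> [u v] [u' v'] _ _ /= [-> ->].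
move=> /= _ _ /allpairsPdep[m [w [mi wm ->]]] /allpairsPdep[m' [w' [mi' wm' ->]]] /= Eww.
rewrite -{}Eww in wm' *.
suff -> : m = m' by [].
move: mi mi'; rewrite !mem_iota => mi mi'.
case/allpairsPdep: wm => -[a x] [v [ax _ Ew]].
case/allpairsPdep: wm' => -[a' x'] [v' [ax' _ Ew']].
move: Ew'; rewrite {}Ew => -[Ea Ex _]; subst.
by move: ax ax'; rewrite !mem_divpairs; lia.
Qed.

Lemma sum_quads_bij (V : nmodType) n (C D : pred ((nat * nat) * (nat * nat)))
    (f g : (nat * nat) * (nat * nat) -> (nat * nat) * (nat * nat))
    (F : (nat * nat) * (nat * nat) -> V) :
  (forall t, t \in quads n -> C t -> [/\ f t \in quads n, D (f t) & g (f t) = t]) ->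
  (forall t, t \in quads n -> D t -> [/\ g t \in quads n, C (g t) & f (g t) = t]) ->
  \sum_(t <- quads n | C t) F (f t) = \sum_(t <- quads n | D t) F t.
Proof.
move=> Hf Hg.
rewrite -big_filter -(big_map f xpredT F) -[RHS]big_filter; apply: perm_big.
apply: uniq_perm; rewrite ?filter_uniq ?uniq_quads //.
  rewrite map_inj_in_uniq ?filter_uniq ?uniq_quads // => s t.
  rewrite !mem_filter => /andP[Cs sq] /andP[Ct tq] E.
  by have [_ _ <-] := Hf s sq Cs; have [_ _ <-] := Hf t tq Ct; rewrite E.
move=> t; rewrite mem_filter; apply/mapP/andP => [[s]|[Dt tq]].
  by rewrite mem_filter => /andP[Cs sq] ->; have [] := Hf s sq Cs.
have [gq Cg fg] := Hg t tq Dt.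
by exists (g t); [rewrite mem_filter Cg gq | rewrite fg].
Qed.

(** From a x + b y = (a + b) x + b (y - x). *)
Lemma sum_quads_shift (V : nmodType) n (F : nat -> nat -> V) :
  \sum_(t <- quads n | (t.1.2 < t.2.2)%N) F t.1.2 (t.2.2 - t.1.2)%N
  = \sum_(t <- quads n | (t.2.1 < t.1.1)%N) F t.1.2 t.2.2.
Proof.
apply: (@sum_quads_bij V n (fun t => t.1.2 < t.2.2)%N (fun t => t.2.1 < t.1.1)%N
  (fun t => ((t.1.1 + t.2.1, t.1.2), (t.2.1, t.2.2 - t.1.2)))%N
  (fun t => ((t.1.1 - t.2.1, t.1.2), (t.2.1, t.2.2 + t.1.2)))%N
  (fun t => F t.1.2 t.2.2)) => -[[a x] [b y]] /=.
  rewrite !mem_quads => /and5P[a0 x0 b0 y0 /eqP E] xy; split.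
  - by apply/and5P; split; nia.
  - by lia.
  - by congr (_, _, (_, _)); lia.
rewrite !mem_quads => /and5P[a0 x0 b0 y0 /eqP E] ba; split.
- by apply/and5P; split; nia.
- by lia.
- by congr (_, _, (_, _)); lia.
Qed.

Lemma sum_quads_swap (V : nmodType) n (C : nat -> nat -> nat -> nat -> bool)
    (F : nat -> nat -> V) :
  \sum_(t <- quads n | C t.1.1 t.1.2 t.2.1 t.2.2) F t.1.2 t.2.2
  = \sum_(t <- quads n | C t.2.1 t.2.2 t.1.1 t.1.2) F t.2.2 t.1.2.
Proof.
apply/esym; apply: (@sum_quads_bij V n (fun t => C t.2.1 t.2.2 t.1.1 t.1.2)
  (fun t => C t.1.1 t.1.2 t.2.1 t.2.2) (fun t => (t.2, t.1))
  (fun t => (t.2, t.1)) (fun t => F t.1.2 t.2.2)) => -[[a x] [b y]] /=;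
  by rewrite !mem_quads addnC => /and5P[-> -> -> -> ->].
Qed.

Lemma sum_tri (V : nmodType) (T : Type) (s : seq T) (u v : T -> nat) (F : T -> V) :
  \sum_(t <- s) F t = \sum_(t <- s | (u t < v t)%N) F t
    + \sum_(t <- s | (v t < u t)%N) F t + \sum_(t <- s | u t == v t) F t.
Proof.
elim: s => [|t s IH]; first by rewrite !big_nil !addr0.
rewrite !big_cons IH; case: (ltngtP (u t) (v t)) => _.
- by rewrite -!addrA.
- by rewrite [X in _ = X + _]addrCA -!addrA.
- by rewrite [in RHS]addrCA -!addrA.
Qed.

(** The sums of P over all solutions can be split by comparing x with y or by
comparing a with b.  By [sum_quads_shift] the unequal parts of the second
splitting are the sums of the shifted values, so only the diagonal terms
survive. *)
Lemma sum_quads_sub n (P : nat -> nat -> int) :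
  \sum_(t <- quads n | (t.1.2 < t.2.2)%N) (P t.1.2 t.2.2 - P t.1.2 (t.2.2 - t.1.2)%N)
  + \sum_(t <- quads n | (t.2.2 < t.1.2)%N) (P t.1.2 t.2.2 - P (t.1.2 - t.2.2)%N t.2.2)
  = \sum_(t <- quads n | t.1.1 == t.2.1) P t.1.2 t.2.2
    - \sum_(t <- quads n | t.1.2 == t.2.2) P t.1.2 t.2.2.
Proof.
have E1 := sum_tri (quads n) (fun t => t.1.2) (fun t => t.2.2) (fun t => P t.1.2 t.2.2).
have := sum_tri (quads n) (fun t => t.1.1) (fun t => t.2.1) (fun t => P t.1.2 t.2.2).
rewrite {}E1 !sumrB sum_quads_shift.
have -> : \sum_(t <- quads n | (t.2.2 < t.1.2)%N) P (t.1.2 - t.2.2)%N t.2.2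
    = \sum_(t <- quads n | (t.1.1 < t.2.1)%N) P t.1.2 t.2.2.
  rewrite (sum_quads_swap n (fun a _ b _ => a < b)%N).
  rewrite -(sum_quads_shift n (fun x y => P y x)).
  by rewrite (sum_quads_swap n (fun _ x _ y => y < x)%N (fun x y => P (x - y)%N y)).
by move=> H; lra.
Qed.

Lemma sum_quads_diag_weight n (P : nat -> nat -> int) : (0 < n)%N ->
  \sum_(t <- quads n | t.1.1 == t.2.1) P t.1.2 t.2.2
  = \sum_(d <- divisors n) \sum_(x <- iota 1 d.-1) P x (d - x)%N.
Proof.
move=> n0; rewrite -big_filter.
pose s := [seq (((n %/ d, x), (n %/ d, d - x)))%N | d <- divisors n, x <- iota 1 d.-1].
have -> : \sum_(d <- divisors n) \sum_(x <- iota 1 d.-1) P x (d - x)%N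
    = \sum_(t <- s) P t.1.2 t.2.2 by rewrite big_allpairs_dep.
apply: perm_big; apply: uniq_perm; rewrite ?filter_uniq ?uniq_quads //.
  apply: allpairs_uniq_dep => [|d _|]; rewrite ?divisors_uniq ?iota_uniq //.
  move=> /= _ _ /allpairsPdep[d [x [dn xd ->]]] /allpairsPdep[d' [x' [dn' xd' ->]]] /=.
  move: xd xd'; rewrite !mem_iota => xd xd' [_ Ex _ Ed].
  suff -> : d = d' by rewrite Ex.
  lia.
move=> [[a x] [b y]]; rewrite mem_filter mem_quads /=.
apply/andP/allpairsPdep => [[/eqP <- /and5P[a0 x0 _ y0 /eqP E]]|[d [x' [dn xd]]]].
  exists (x + y)%N, x; rewrite -dvdn_divisors // mem_iota.
  have E' : n = (a * (x + y))%N by lia.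
  split; [by rewrite E' dvdn_mull | by lia |].
  by rewrite E' mulnK ?addKn // addn_gt0 x0.
move: dn xd; rewrite -dvdn_divisors // mem_iota => dn xd [-> -> -> ->].
split=> //; have := divnK dn; set q := (n %/ d)%N => E.
by apply/and5P; split; nia.
Qed.

Lemma sum_quads_diag n (P : nat -> nat -> int) : (0 < n)%N ->
  \sum_(t <- quads n | t.1.2 == t.2.2) P t.1.2 t.2.2
  = \sum_(d <- divisors n) ((n %/ d)%N%:Z - 1) * P d d.
Proof.
move=> n0; rewrite -big_filter.
pose s := [seq (((a, d), (n %/ d - a, d)))%N | d <- divisors n, a <- iota 1 (n %/ d).-1].
have -> : \sum_(d <- divisors n) ((n %/ d)%N%:Z - 1) * P d d
    = \sum_(t <- s) P t.1.2 t.2.2.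
  rewrite big_allpairs_dep; apply: eq_big_seq => d /=; rewrite -dvdn_divisors // => dn.
  rewrite big_const_seq count_predT size_iota iter_addr_0.
  have : (0 < n %/ d)%N by rewrite divn_gt0 ?(dvdn_gt0 n0 dn) // dvdn_leq.
  case: (n %/ d)%N => // m _ /=.
  by rewrite -addn1 PoszD addrK -mulr_natl natz.
apply: perm_big; apply: uniq_perm; rewrite ?filter_uniq ?uniq_quads //.
  apply: allpairs_uniq_dep => [|d _|]; rewrite ?divisors_uniq ?iota_uniq //.
  move=> /= _ _ /allpairsPdep[d [x [dn xd ->]]] /allpairsPdep[d' [x' [dn' xd' ->]]] /=.
  by case=> -> ->.
move=> [[a x] [b y]]; rewrite mem_filter mem_quads /=.
apply/andP/allpairsPdep => [[/eqP <- /and5P[a0 x0 b0 _ /eqP E]]|[d [a' [dn ad]]]].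
  exists x, a; rewrite -dvdn_divisors // mem_iota.
  have E' : n = ((a + b) * x)%N by lia.
  split; [by rewrite E' dvdn_mull | by rewrite E' mulnK; lia |].
  by rewrite E' mulnK ?addKn.
move: dn ad; rewrite -dvdn_divisors // mem_iota => dn ad [-> -> -> ->].
split=> //; have := divnK dn; move: ad; set q := (n %/ d)%N => ad E.
by apply/and5P; split; nia.
Qed.

Lemma sum_quads_conv n i j :
  \sum_(t <- quads n) t.1.2%:Z ^+ i * t.2.2%:Z ^+ j
  = \sum_(m <- iota 1 n.-1) (sigma i m)%:Z * (sigma j (n - m))%:Z.
Proof.
rewrite big_allpairs_dep; apply: eq_bigr => m _.
rewrite big_allpairs_dep !sigmaE big_map mulr_suml; apply: eq_bigr => d _ /=.
by rewrite big_map mulr_sumr.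
Qed.

Lemma dsym_sub (x y : nat) : (x <= y)%N ->
  dsym x%:Z (y - x)%N%:Z = dsym x%:Z y%:Z - rform (y - x)%N%:Z y%:Z.
Proof.
move=> xy; have -> : y%:Z = x%:Z + (y - x)%N%:Z by lia.
set w := (y - x)%N%:Z.
have -> : dsym x (x%:Z + w) = dsym w (x%:Z + w).
  by rewrite -dsymNl -dsymD1 addrA addNr add0r.
rewrite (dsymC w) addrK dsymD1; first by [].
Qed.

(** This is [sum_quads_sub] for P = [dsym], which vanishes on the diagonal.  Its
shifts in the first variable are trivial by periodicity, and those in the
second variable are values of [rform] by reciprocity. *)
Lemma musum_quads n : (0 < n)%N ->
  \sum_(t <- quads n | (t.1.2 < t.2.2)%N) rform (t.2.2 - t.1.2)%N%:Z t.2.2%:Z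
  = musum n - \sum_(d <- divisors n) \sum_(x <- iota 1 d.-1) rform (d - x)%N%:Z d%:Z.
Proof.
move=> n0; have := sum_quads_sub n (fun x y => dsym x%:Z y%:Z).
rewrite [X in _ + X]big1 ?addr0; last first.
  move=> t tt; have -> : t.1.2%:Z = (t.1.2 - t.2.2)%N%:Z + t.2.2%:Z by lia.
  by rewrite dsymD1 subrr.
have -> : \sum_(t <- quads n | t.1.2 == t.2.2) dsym t.1.2%:Z t.2.2%:Z = 0.
  by rewrite big1 // => t /eqP ->; rewrite -[X in dsym X]add0r dsymD1 dsymC dsym0 rform0l.
rewrite subr0 (@sum_quads_diag_weight n (fun x y => dsym x%:Z y%:Z)) // => H.
transitivity (\sum_(d <- divisors n) \sum_(x <- iota 1 d.-1) dsym x (d - x)%N).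
  rewrite -H; apply: eq_bigr => t tt.
  by rewrite dsym_sub ?(ltnW tt) // opprB addrC subrK.
rewrite /musum -sumrB; apply: eq_big_seq => d; rewrite -dvdn_divisors // => dn.
case: d dn => [|d] _.
  by rewrite /dsum big_ord0 !big_nil subr0.
rewrite /dsum big_ord_recl /= dsymC dsym0 rform0l !add0r.
have -> : \sum_(i < d) dsym (bump 0 i)%:Z d.+1%:Z = \sum_(x <- iota 1 d) dsym x%:Z d.+1%:Z.
  by rewrite -(big_mkord xpredT (fun i => dsym (bump 0 i)%:Z d.+1%:Z)) /index_iota subn0 -[1%N]addn0 iotaDl big_map.
rewrite -sumrB; apply: eq_big_seq => x; rewrite mem_iota => xd.
by rewrite dsym_sub //; lia.
Qed.

(** * Convolutions of divisor functions *)

Lemma sum_telescope (F G : int -> int) d : (forall x, G (x + 1) - G x = F x) ->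
  (0 < d)%N -> \sum_(x <- iota 1 d.-1) F x%:Z = G d%:Z - G 1.
Proof.
move=> H; case: d => // d _ /=.
elim: d => [|d IH]; first by rewrite big_nil subrr.
have -> : iota 1 d.+1 = iota 1 d ++ [:: d.+1] by rewrite -{1}[d.+1]addn1 iotaD.
rewrite big_cat big_seq1 IH -H /=.
have -> : d.+2%:Z = d.+1%:Z + 1 by lia.
ring.
Qed.

(** Applying [sum_quads_sub] to a symmetric polynomial P, the shifts of P can be
arranged to produce a symmetric Q, whose monomials sum to convolutions of
divisor functions, up to a multiple K of the term that produces [musum].  The
polynomial g sums the diagonal terms by telescoping. *)
Lemma conv_identity (P Q g : int -> int -> int) (K : int) n :
  (forall x y, P x y = P y x) -> (forall x y, Q x y = Q y x) ->
  (forall x y, 2 * (P x y - P x (y - x) + Q x y) = K * rform (y - x) y) ->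
  (forall x d, g (x + 1) d - g x d = P x (d - x) + K * rform (d - x) d) ->
  (0 < n)%N ->
  \sum_(t <- quads n) Q t.1.2%:Z t.2.2%:Z = K * musum n
   + \sum_(d <- divisors n) (((n %/ d)%N%:Z - 1) * (P d%:Z d%:Z + Q d%:Z d%:Z)
       - (g d%:Z d%:Z - g 1 d%:Z)).
Proof.
move=> Psym Qsym H1 H2 n0.
have EP := sum_quads_sub n (fun x y => P x%:Z y%:Z).
rewrite (sum_quads_swap n (fun _ x _ y => y < x)%N
  (fun x y => P x%:Z y%:Z - P (x - y)%N%:Z y%:Z)) /= in EP.
have EQ := sum_tri (quads n) (fun t => t.1.2) (fun t => t.2.2)
  (fun t => Q t.1.2%:Z t.2.2%:Z).
rewrite (sum_quads_swap n (fun _ x _ y => y < x)%N (fun x y => Q x%:Z y%:Z)) /= in EQ.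
have EM : K * \sum_(t <- quads n | (t.1.2 < t.2.2)%N) rform (t.2.2 - t.1.2)%N%:Z t.2.2%:Z
  = \sum_(t <- quads n | (t.1.2 < t.2.2)%N) (P t.1.2%:Z t.2.2%:Z - P t.1.2%:Z (t.2.2 - t.1.2)%N%:Z)
  + \sum_(t <- quads n | (t.1.2 < t.2.2)%N) (P t.2.2%:Z t.1.2%:Z - P (t.2.2 - t.1.2)%N%:Z t.1.2%:Z)
  + (\sum_(t <- quads n | (t.1.2 < t.2.2)%N) Q t.1.2%:Z t.2.2%:Z
  + \sum_(t <- quads n | (t.1.2 < t.2.2)%N) Q t.2.2%:Z t.1.2%:Z).
  rewrite -!big_split mulr_sumr; apply: eq_bigr => t tt /=.
  by rewrite -subzn ?(ltnW tt) // -H1 !(Psym _ t.1.2%:Z) (Qsym _ t.1.2%:Z); ring.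
rewrite musum_quads // mulrBr EP in EM.
rewrite (@sum_quads_diag_weight n (fun x y => P x%:Z y%:Z)) // in EM.
rewrite (@sum_quads_diag n (fun x y => P x%:Z y%:Z)) // in EM.
rewrite (@sum_quads_diag n (fun x y => Q x%:Z y%:Z)) // in EQ.
have ET : \sum_(d <- divisors n) (g d%:Z d%:Z - g 1 d%:Z)
  = \sum_(d <- divisors n) \sum_(x <- iota 1 d.-1) P x%:Z (d - x)%N%:Z
  + K * \sum_(d <- divisors n) \sum_(x <- iota 1 d.-1) rform (d - x)%N%:Z d%:Z.
  rewrite mulr_sumr -big_split; apply: eq_big_seq => d; rewrite -dvdn_divisors // => dn.
  rewrite /= mulr_sumr -big_split /=.
  rewrite -(sum_telescope (fun x => H2 x d%:Z)) ?(dvdn_gt0 n0 dn) //.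
  apply: eq_big_seq => x; rewrite mem_iota => xd.
  by rewrite -subzn //; lia.
have ED : \sum_(d <- divisors n) ((n %/ d)%N%:Z - 1) * (P d%:Z d%:Z + Q d%:Z d%:Z)
  = \sum_(d <- divisors n) ((n %/ d)%N%:Z - 1) * P d%:Z d%:Z
  + \sum_(d <- divisors n) ((n %/ d)%N%:Z - 1) * Q d%:Z d%:Z.
  by rewrite -big_split; apply: eq_bigr => d _; rewrite mulrDr.
rewrite sumrB ED ET EQ; lra.
Qed.

Definition sconv (i j n : nat) : int :=
  \sum_(m <- iota 1 n.-1) (sigma i m)%:Z * (sigma j (n - m))%:Z.

Lemma sconvC i j n : sconv i j n = sconv j i n.
Proof.
rewrite /sconv -!sum_quads_conv (sum_quads_swap n (fun _ _ _ _ => true) (fun x y => x%:Z ^+ i * y%:Z ^+ j)).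
by apply: eq_bigr => t _; rewrite mulrC.
Qed.

Lemma sum_quads_sconv n (c : int) i j :
  \sum_(t <- quads n) c * (t.1.2%:Z ^+ i * t.2.2%:Z ^+ j) = c * sconv i j n.
Proof. by rewrite -mulr_sumr sum_quads_conv. Qed.

Lemma sum_div_sigma n (c : int) k :
  \sum_(d <- divisors n) c * d%:Z ^+ k = c * (sigma k n)%:Z.
Proof. by rewrite -mulr_sumr sigmaE. Qed.

(** The same identity with the diagonal terms collected into a polynomial T in
the divisor; u is the value of P + Q at (1, 1). *)
Lemma conv_identity_sigma n (c c' : int) i j (P Q g : int -> int -> int) (K u : int) k T :
  (forall x y, P x y = P y x) -> (forall x y, Q x y = c * (x ^+ i * y ^+ j) + c' * (y ^+ i * x ^+ j)) ->
  (forall x y, Q x y = Q y x) ->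
  (forall x y, 2 * (P x y - P x (y - x) + Q x y) = K * rform (y - x) y) ->
  (forall x d, g (x + 1) d - g x d = P x (d - x) + K * rform (d - x) d) ->
  (forall d, P d d + Q d d = u * (d * d ^+ k)) ->
  (forall d, u * (d * d ^+ k) + (g d d - g 1 d) = T d) ->
  (0 < n)%N ->
  (c + c') * sconv i j n + \sum_(d <- divisors n) T d%:Z
    = K * musum n + u * n%:Z * (sigma k n)%:Z.
Proof.
move=> Psym QE Qsym H1 H2 H3 H4 n0.
have := conv_identity Psym Qsym H1 H2 n0.
rewrite (eq_bigr _ (fun t _ => QE t.1.2%:Z t.2.2%:Z)) big_split /= sum_quads_sconv.
have -> : \sum_(t <- quads n) c' * (t.2.2%:Z ^+ i * t.1.2%:Z ^+ j) = c' * sconv i j n.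
  rewrite sconvC -sum_quads_sconv; apply: eq_bigr => t _; ring.
rewrite mulrDl => ->; rewrite -addrA -big_split; congr (_ + _).
rewrite -mulrA sigmaE mulrA mulr_sumr; apply: eq_big_seq => d.
rewrite -dvdn_divisors // => dn /=; rewrite -H4 H3.
have -> : n%:Z = (n %/ d)%N%:Z * d%:Z by rewrite -PoszM divnK.
ring.
Qed.

Ltac poly_side := by move=> *; rewrite ?/rform; ring.

(** In this lemma and its companions P and Q are found by linear algebra, as a
solution of P(x, y) - P(x, y - x) + Q(x, y) = (K / 2) r(y - x, y), scaled so
that the telescoping polynomial g, a combination of Bernoulli polynomials in x,
has integral coefficients.  Below degree 10 there is no cusp form and K = 0. *)
Lemma sconv11 n : (0 < n)%N ->
  12 * sconv 1 1 n + 6 * n%:Z * (sigma 1 n)%:Z = 5 * (sigma 3 n)%:Z + (sigma 1 n)%:Z.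
Proof.
move=> n0.
have := @conv_identity_sigma n 12 0 1 1 (fun x y => - 6 * x ^+ 2 - 6 * x * y - 6 * y ^+ 2)
  (fun x y => 12 * x * y)
  (fun x d => - 2 * x ^+ 3 + 3 * x ^+ 2 * d + 3 * x ^+ 2 - 6 * x * d ^+ 2 - 3 * x * d -
    x)
  0 (-6) 1 (fun d => -5 * d ^+ 3 + -1 * d ^+ 1).
move=> H; move: (H ltac:(poly_side) ltac:(poly_side) ltac:(poly_side) ltac:(poly_side)
  ltac:(poly_side) ltac:(poly_side) ltac:(poly_side) n0).
rewrite big_split /= !sum_div_sigma; lra.
Qed.

(** Reduces a goal that is a linear consequence of a known equation to a ring
identity, in which large coefficients are harmless. *)
Lemma eq_from_sub (V : zmodType) (a b c d : V) : a = b -> c - d = a - b -> c = d.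
Proof. by move=> -> /eqP; rewrite subrr subr_eq0 => /eqP. Qed.

Lemma sconv13 n : (0 < n)%N ->
  120 * sconv 1 3 n + 120 * sconv 1 3 n + 30 * n%:Z * (sigma 3 n)%:Z
  = 21 * (sigma 5 n)%:Z + 10 * (sigma 3 n)%:Z - (sigma 1 n)%:Z.
Proof.
move=> n0.
have H := @conv_identity_sigma n 120 120 3 1
  (fun x y => - 30 * x ^+ 4 - 60 * x ^+ 3 * y - 90 * x ^+ 2 * y ^+ 2 - 60 * x * y ^+ 3 -
    30 * y ^+ 4)
  (fun x y => 120 * x ^+ 3 * y + 120 * x * y ^+ 3)
  (fun x d => - 6 * x ^+ 5 + 15 * x ^+ 4 * d + 15 * x ^+ 4 - 30 * x ^+ 3 * d ^+ 2 - 30 *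
    x ^+ 3 * d - 10 * x ^+ 3 + 30 * x ^+ 2 * d ^+ 3 + 45 * x ^+ 2 * d ^+ 2 + 15 * x ^+ 2
    * d - 30 * x * d ^+ 4 - 30 * x * d ^+ 3 - 15 * x * d ^+ 2 + x)
  (0) (-30) 3 (fun d => -21 * d ^+ 5 + -10 * d ^+ 3 + 1 * d ^+ 1).
move: (H ltac:(poly_side) ltac:(poly_side) ltac:(poly_side) ltac:(poly_side)
  ltac:(poly_side) ltac:(poly_side) ltac:(poly_side) n0).
rewrite !big_split /= !sum_div_sigma sconvC => E.
by apply: (eq_from_sub E); ring.
Qed.

Lemma sconv15 n : (0 < n)%N ->
  504 * sconv 1 5 n + 504 * sconv 1 5 n + 84 * n%:Z * (sigma 5 n)%:Z
  = 40 * (sigma 7 n)%:Z + 42 * (sigma 5 n)%:Z + 2 * (sigma 1 n)%:Z.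
Proof.
move=> n0.
have H := @conv_identity_sigma n 504 504 5 1
  (fun x y => - 84 * x ^+ 6 - 252 * x ^+ 5 * y - 210 * x ^+ 4 * y ^+ 2 - 210 * x ^+ 2 *
    y ^+ 4 - 252 * x * y ^+ 5 - 84 * y ^+ 6)
  (fun x y => 504 * x ^+ 5 * y + 504 * x * y ^+ 5)
  (fun x d => - 12 * x ^+ 7 + 42 * x ^+ 6 * d + 42 * x ^+ 6 - 42 * x ^+ 5 * d ^+ 2 - 126
    * x ^+ 5 * d - 42 * x ^+ 5 + 105 * x ^+ 4 * d ^+ 2 + 105 * x ^+ 4 * d - 70 * x ^+ 3
    * d ^+ 4 - 70 * x ^+ 3 * d ^+ 2 + 14 * x ^+ 3 + 126 * x ^+ 2 * d ^+ 5 + 105 * x ^+ 2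
    * d ^+ 4 - 21 * x ^+ 2 * d - 84 * x * d ^+ 6 - 126 * x * d ^+ 5 - 35 * x * d ^+ 4 +
    7 * x * d ^+ 2 - 2 * x)
  (0) (-84) 5 (fun d => -40 * d ^+ 7 + -42 * d ^+ 5 + -2 * d ^+ 1).
move: (H ltac:(poly_side) ltac:(poly_side) ltac:(poly_side) ltac:(poly_side)
  ltac:(poly_side) ltac:(poly_side) ltac:(poly_side) n0).
rewrite !big_split /= !sum_div_sigma sconvC => E.
by apply: (eq_from_sub E); ring.
Qed.

Lemma sconv33 n : (0 < n)%N ->
  120 * sconv 3 3 n = (sigma 7 n)%:Z - (sigma 3 n)%:Z.
Proof.
move=> n0.
have H := @conv_identity_sigma n 120 0 3 3
  (fun x y => - 30 * x ^+ 4 * y ^+ 2 - 60 * x ^+ 3 * y ^+ 3 - 30 * x ^+ 2 * y ^+ 4)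
  (fun x y => 120 * x ^+ 3 * y ^+ 3)
  (fun x d => - 6 * x ^+ 5 * d ^+ 2 + 15 * x ^+ 4 * d ^+ 3 + 15 * x ^+ 4 * d ^+ 2 - 10 *
    x ^+ 3 * d ^+ 4 - 30 * x ^+ 3 * d ^+ 3 - 10 * x ^+ 3 * d ^+ 2 + 15 * x ^+ 2 * d ^+ 4
    + 15 * x ^+ 2 * d ^+ 3 - 5 * x * d ^+ 4 + x * d ^+ 2)
  (0) (0) 5 (fun d => -1 * d ^+ 7 + 1 * d ^+ 3).
move: (H ltac:(poly_side) ltac:(poly_side) ltac:(poly_side) ltac:(poly_side)
  ltac:(poly_side) ltac:(poly_side) ltac:(poly_side) n0).
rewrite !big_split /= !sum_div_sigma => E.
by apply: (eq_from_sub E); ring.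
Qed.

Lemma sconv37 n : (0 < n)%N ->
  1440 * sconv 3 7 n + 1440 * sconv 3 7 n = 300 * musum n
  + 18 * (sigma 11 n)%:Z - 12 * (sigma 7 n)%:Z - 6 * (sigma 3 n)%:Z.
Proof.
move=> n0.
have H := @conv_identity_sigma n 1440 1440 7 3
  (fun x y => - 330 * x ^+ 8 * y ^+ 2 - 720 * x ^+ 7 * y ^+ 3 - 390 * x ^+ 6 * y ^+ 4 -
    390 * x ^+ 4 * y ^+ 6 - 720 * x ^+ 3 * y ^+ 7 - 330 * x ^+ 2 * y ^+ 8)
  (fun x y => 1440 * x ^+ 7 * y ^+ 3 + 1440 * x ^+ 3 * y ^+ 7)
  (fun x d => - 20 * x ^+ 9 * d ^+ 2 - 60 * x ^+ 8 * d ^+ 3 + 90 * x ^+ 8 * d ^+ 2 + 480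
    * x ^+ 7 * d ^+ 4 + 240 * x ^+ 7 * d ^+ 3 - 120 * x ^+ 7 * d ^+ 2 - 950 * x ^+ 6 * d
    ^+ 5 - 1680 * x ^+ 6 * d ^+ 4 - 280 * x ^+ 6 * d ^+ 3 + 762 * x ^+ 5 * d ^+ 6 + 2850
    * x ^+ 5 * d ^+ 5 + 1680 * x ^+ 5 * d ^+ 4 + 84 * x ^+ 5 * d ^+ 2 - 120 * x ^+ 4 * d
    ^+ 7 - 1905 * x ^+ 4 * d ^+ 6 - 2375 * x ^+ 4 * d ^+ 5 + 140 * x ^+ 4 * d ^+ 3 - 110
    * x ^+ 3 * d ^+ 8 + 240 * x ^+ 3 * d ^+ 7 + 1270 * x ^+ 3 * d ^+ 6 - 560 * x ^+ 3 *
    d ^+ 4 - 40 * x ^+ 3 * d ^+ 2 + 165 * x ^+ 2 * d ^+ 8 - 120 * x ^+ 2 * d ^+ 7 + 475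
    * x ^+ 2 * d ^+ 5 - 40 * x ^+ 2 * d ^+ 3 - 55 * x * d ^+ 8 - 127 * x * d ^+ 6 + 80 *
    x * d ^+ 4 + 6 * x * d ^+ 2)
  (300) (0) 9 (fun d => -18 * d ^+ 11 + 12 * d ^+ 7 + 6 * d ^+ 3).
move: (H ltac:(poly_side) ltac:(poly_side) ltac:(poly_side) ltac:(poly_side)
  ltac:(poly_side) ltac:(poly_side) ltac:(poly_side) n0).
rewrite !big_split /= !sum_div_sigma sconvC => E.
by apply: (eq_from_sub E); ring.
Qed.

Lemma sconv55 n : (0 < n)%N ->
  1008 * sconv 5 5 n = - 84 * musum n - 4 * (sigma 11 n)%:Z + 4 * (sigma 5 n)%:Z.
Proof.
move=> n0.
have H := @conv_identity_sigma n 1008 0 5 5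
  (fun x y => 42 * x ^+ 8 * y ^+ 2 - 294 * x ^+ 6 * y ^+ 4 - 504 * x ^+ 5 * y ^+ 5 - 294
    * x ^+ 4 * y ^+ 6 + 42 * x ^+ 2 * y ^+ 8)
  (fun x y => 1008 * x ^+ 5 * y ^+ 5)
  (fun x d => 42 * x ^+ 8 * d ^+ 3 - 192 * x ^+ 7 * d ^+ 4 - 168 * x ^+ 7 * d ^+ 3 + 350
    * x ^+ 6 * d ^+ 5 + 672 * x ^+ 6 * d ^+ 4 + 196 * x ^+ 6 * d ^+ 3 - 294 * x ^+ 5 * d
    ^+ 6 - 1050 * x ^+ 5 * d ^+ 5 - 672 * x ^+ 5 * d ^+ 4 + 84 * x ^+ 4 * d ^+ 7 + 735 *
    x ^+ 4 * d ^+ 6 + 875 * x ^+ 4 * d ^+ 5 - 98 * x ^+ 4 * d ^+ 3 + 14 * x ^+ 3 * d ^+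
    8 - 168 * x ^+ 3 * d ^+ 7 - 490 * x ^+ 3 * d ^+ 6 + 224 * x ^+ 3 * d ^+ 4 - 21 * x
    ^+ 2 * d ^+ 8 + 84 * x ^+ 2 * d ^+ 7 - 175 * x ^+ 2 * d ^+ 5 + 28 * x ^+ 2 * d ^+ 3
    + 7 * x * d ^+ 8 + 49 * x * d ^+ 6 - 32 * x * d ^+ 4)
  (-84) (0) 9 (fun d => 4 * d ^+ 11 + -4 * d ^+ 5).
move: (H ltac:(poly_side) ltac:(poly_side) ltac:(poly_side) ltac:(poly_side)
  ltac:(poly_side) ltac:(poly_side) ltac:(poly_side) n0).
rewrite !big_split /= !sum_div_sigma => E.
by apply: (eq_from_sub E); ring.
Qed.

(** * Eisenstein series and the product expansion *)

(** Equality of power series up to q^N.  Writing it with an explicit multiple of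
'X^(N.+1) makes it compatible with products by plain ring computations. *)
Definition eqtr (N : nat) (p q : {poly int}) := exists R, p = q + 'X^(N.+1) * R.

Lemma eqtrP N (p q : {poly int}) : (forall n, (n <= N)%N -> p`_n = q`_n) -> eqtr N p q.
Proof.
move=> H; exists (drop_poly N.+1 (p - q)).
have : take_poly N.+1 (p - q) = 0.
  apply/polyP => i; rewrite coef_take_poly coef0 coefB.
  by case: ltnP => // iN; rewrite H // subrr.
have := poly_take_drop N.+1 (p - q) => /[swap] ->; rewrite add0r mulrC => ->.
by rewrite addrC subrK.
Qed.

Lemma eqtr_coef N (p q : {poly int}) n : eqtr N p q -> (n <= N)%N -> p`_n = q`_n.
Proof. by case=> R -> nN; rewrite coefD coefXnM ltnS nN addr0. Qed.

(** The Eisenstein series with constant term 1, truncated after q^N. *)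
Definition eis (N k : nat) (c : int) : {poly int} :=
  \poly_(n < N.+1) (if n == 0%N then 1 else c * (sigma k n)%:Z).

Lemma coef_eis N k c n : (n <= N)%N ->
  (eis N k c)`_n = if n == 0%N then 1 else c * (sigma k n)%:Z.
Proof. by move=> nN; rewrite coef_poly ltnS nN. Qed.

Lemma coef_eisM N k c l e n : (0 < n <= N)%N ->
  (eis N k c * eis N l e)`_n
  = c * (sigma k n)%:Z + e * (sigma l n)%:Z + c * e * sconv k l n.
Proof.
case: n => // n /= nN; rewrite coefM big_ord_recl big_ord_recr /= /bump /= !subnn.
set S := \sum_(i < n) _.
have -> : S = c * e * sconv k l n.+1; last by rewrite !add1n subn0 !coef_eis //=; ring.
rewrite /sconv /= mulr_sumr -[1%N]addn0 iotaDl big_map -[n in iota 0 n]subn0.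
rewrite -/(index_iota 0 n) big_mkord; apply: eq_bigr => i _.
have iN := ltn_ord i.
rewrite /bump !add1n subSS !coef_eis; try lia.
by rewrite subn_eq0 leqNgt iN /=; ring.
Qed.

Section Ramanujan.
Variable N : nat.
Let E2 := eis N 1 (-24).
Let E4 := eis N 3 240.
Let E6 := eis N 5 (-504).
Let E8 := eis N 7 480.

Lemma ramanujan_E4 : eqtr N (3%:P * ('X * E4^`())) (E2 * E4 - E6).
Proof.
apply: eqtrP => n nN; rewrite coefCM coefXM coefB.
case: n nN => [|n] nN /=.
  by rewrite coefM big_ord1 !coef_eis.
rewrite coef_deriv coef_eisM // !coef_eis //= -mulr_natr.
have := sconv13 (ltn0Sn n) => E; apply: (eq_from_sub (congr1 (fun x => 24 * x) E)).
rewrite natz; ring.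
Qed.

Lemma ramanujan_E6 : eqtr N (2%:P * ('X * E6^`())) (E2 * E6 - E8).
Proof.
apply: eqtrP => n nN; rewrite coefCM coefXM coefB.
case: n nN => [|n] nN /=.
  by rewrite coefM big_ord1 !coef_eis.
rewrite coef_deriv coef_eisM // !coef_eis //= -mulr_natr.
have := sconv15 (ltn0Sn n) => E; apply: (eq_from_sub (congr1 (fun x => - 12 * x) E)).
rewrite natz; ring.
Qed.

Lemma eis4_sqr : eqtr N (E4 * E4) E8.
Proof.
apply: eqtrP => n nN; case: n nN => [|n] nN.
  by rewrite coefM big_ord1 !coef_eis.
rewrite coef_eisM // !coef_eis //=.
have := sconv33 (ltn0Sn n) => E; apply: (eq_from_sub (congr1 (fun x => 480 * x) E)).
ring.
Qed.

Let G := E4 ^+ 3 - E6 ^+ 2.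

(** Replacing E_4^3 by E_4 E_8 leaves products of two Eisenstein series, whose
coefficients are the convolutions sigma_3 * sigma_7 and sigma_5 * sigma_5. *)
Lemma coef_disc n : (0 < n <= N)%N -> G`_n = 48 * tau36 n.
Proof.
move=> nN; have n0 : (0 < n)%N by case/andP: nN.
have -> : G`_n = (E4 * E8 - E6 * E6)`_n.
  have [R HR] := eis4_sqr.
  apply: (@eqtr_coef N); last by case/andP: nN.
  by exists (E4 * R); rewrite /G exprS expr2 HR; ring.
rewrite coefB !coef_eisM //.
have H1 := sconv37 n0; have H2 := sconv55 n0; rewrite /tau36.
(* The multipliers 40 and 252 turn the relations into those for
   E_4 E_8 and E_6^2: 40 * 2880 = 240 * 480 and 252 * 1008 = 504^2. *)
apply: (eq_from_sub (congr2 (fun x y => 40 * x - 252 * y) H1 H2)).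
ring.
Qed.

(** By [eis4_sqr] the terms E_4^2 E_6 and E_6 E_8 that the two derivative formulas
contribute cancel. *)
Lemma disc_ode : eqtr N ('X * G^`()) (G * E2).
Proof.
have [R4 H4] := ramanujan_E4; have [R6 H6] := ramanujan_E6; have [R8 H8] := eis4_sqr.
exists (E4 ^+ 2 * R4 - E6 * R6 - E6 * R8).
have -> : 'X * G^`() = E4 ^+ 2 * (3%:P * ('X * E4^`())) - E6 * (2%:P * ('X * E6^`())).
  have -> : 3%:P = 3 :> {poly int} by exact: rmorph_nat.
  have -> : 2%:P = 2 :> {poly int} by exact: rmorph_nat.
  rewrite /G expr2 3!exprS expr0 mulr1 derivB !derivM; ring.
rewrite H4 H6.
have -> : E8 = E4 * E4 - 'X^(N.+1) * R8 by rewrite H8 addrK.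
by rewrite /G; ring.
Qed.

(** The coefficient of q^n in q K' = E_2 K reads (n - 1) K_n = a combination of
the earlier coefficients. *)
Lemma ode_zero (K : {poly int}) : eqtr N ('X * K^`()) (K * E2) -> K`_1 = 0 ->
  forall n, (n <= N)%N -> K`_n = 0.
Proof.
move=> ode K1; elim/ltn_ind => n IH nN.
have := eqtr_coef ode nN; rewrite coefXM.
case: n IH nN => [|n] IH nN.
  by rewrite coefM big_ord1 coef_eis // mulr1.
case: n IH nN => [|n] IH nN; first by [].
rewrite coef_deriv coefM big_ord_recr /= subnn coef_eis // mulr1 big1 => [|i _].
  move/eqP; rewrite add0r mulrSr -subr_eq0 addrK -mulr_natr mulf_eq0 orbC /=.
  by case/orP => [|/eqP //]; rewrite natz; lia.
by rewrite IH ?mul0r //; have := ltn_ord i; lia.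
Qed.

(** E is the logarithmic derivative q P' / P of P, up to q^N. *)
Definition logder (P E : {poly int}) := eqtr N ('X * P^`()) (P * E).

Lemma logderM P E Q F : logder P E -> logder Q F -> logder (P * Q) (E + F).
Proof.
move=> [R HP] [S HQ]; exists (R * Q + P * S).
rewrite derivM mulrDr [_ * (_ * Q)]mulrA HP mulrCA HQ; ring.
Qed.

Lemma logder1 : logder 1 0.
Proof. by exists 0; rewrite -[1]/(1%:P) derivC !mulr0 addr0. Qed.

Lemma logderX : logder 'X 1.
Proof. by exists 0; rewrite derivX mulr0 addr0. Qed.

Lemma logder_exp P E n : logder P E -> logder (P ^+ n) (E *+ n).
Proof.
move=> H; elim: n => [|n IH]; first exact: logder1.
by rewrite exprS mulrS; apply: logderM.
Qed.

Lemma logder_factor k : (0 < k)%N ->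
  logder (1 - 'X^k) (- (\sum_(i < N) 'X^(k * i.+1) *+ k)).
Proof.
move=> k0; exists (- ('X^(k * N.+1 - N.+1) *+ k)).
have T : (1 - 'X^k) * (\sum_(i < N) 'X^(k * i.+1)) = 'X^k - 'X^(k * N.+1) :> {poly int}.
  elim: N => [|M IH]; first by rewrite big_ord0 mulr0 muln1 subrr.
  rewrite big_ord_recr mulrDr IH /= [(k * M.+2)%N]mulnS exprD; ring.
have d1 : (1 : {poly int})^`() = 0 by exact: (derivC 1).
rewrite sumrMnl derivB derivXn d1 sub0r mulrN mulrN mulrnAr [in RHS]mulrnAr T.
rewrite -exprS prednK // mulrN mulrnAr -exprD subnKC ?leq_pmull //.
by rewrite -opprD -mulrnDl subrK.
Qed.

(** The logarithmic derivative of (1 - q^k)^24 is - 24 k (q^k + q^(2k) + ...), and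
summing over k collects the divisor sums sigma_1. *)
Lemma delta_logder : logder (delta_trunc N) E2.
Proof.
have H : logder (delta_trunc N)
    (1 + \sum_(1 <= k < N.+1) - (\sum_(i < N) 'X^(k * i.+1) *+ k) *+ 24).
  apply: logderM; first exact: logderX.
  rewrite big_nat_cond [X in logder _ X]big_nat_cond.
  apply: (big_rec2 logder); first exact: logder1.
  move=> k P E /andP[/andP[k0 _] _] H; apply: logderM H.
  exact/logder_exp/logder_factor.
case: H => R HR.
suff [S HS] : eqtr N (1 + \sum_(1 <= k < N.+1) - (\sum_(i < N) 'X^(k * i.+1) *+ k) *+ 24) E2.
  by exists (R + delta_trunc N * S); rewrite HR HS; ring.
apply: eqtrP => n nN; rewrite coefD coef1 coef_eis // coef_sum.
case: n nN => [|n] nN /=.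
  rewrite big_nat_cond big1 ?addr0 // => k /andP[/andP[k0 _] _].
  rewrite coefMn coefN coef_sum big1 ?oppr0 ?mul0rn // => i _.
  by rewrite coefMn coefXn eq_sym muln_eq0 /= gtn_eqF // mul0rn.
rewrite add0r /sigma; set m := n.+1.
have -> : \sum_(1 <= k < N.+1) (- (\sum_(i < N) 'X^(k * i.+1) *+ k) *+ 24)`_m
   = - 24 * \sum_(1 <= k < N.+1 | (k %| m)%N) k%:Z.
  rewrite [X in _ = _ * X]big_mkcond mulr_sumr [LHS]big_nat_cond [RHS]big_nat_cond.
  apply: eq_bigr => k /andP[/andP[k0 kN] _]; rewrite coefMn coefN coef_sum.
  have -> : \sum_(i < N) ('X^(k * i.+1) *+ k : {poly int})`_m
     = if (k %| m)%N then k%:Z else 0.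
    case: ifP => [/dvdnP[q Eq]|km]; last first.
      rewrite big1 // => i _; rewrite coefMn coefXn; case: eqP => [Em|_]; last by rewrite mul0rn.
      by rewrite Em dvdn_mulr in km.
    have q0 : (0 < q)%N by move: (ltn0Sn n); rewrite -/m Eq muln_gt0 => /andP[].
    have qN : (q.-1 < N)%N by rewrite prednK //; apply: leq_trans nN; rewrite -/m Eq leq_pmulr.
    rewrite (bigD1 (Ordinal qN)) //= big1 ?addr0 => [|i].
      by rewrite coefMn coefXn prednK // Eq mulnC eqxx -mulr_natr mul1r natz.
    rewrite -val_eqE /= => iq; rewrite coefMn coefXn; case: eqP => [Em|_]; last by rewrite mul0rn.
    case/negP: iq; move: Em; rewrite Eq mulnC => /eqP; rewrite eqn_pmul2l // => /eqP ->.
    by rewrite eqxx.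
  by rewrite -mulr_natr; ring.
congr (_ * _); rewrite -/(sigma 1 m) sigmaE -[LHS]big_filter.
under [RHS]eq_bigr do rewrite expr1.
apply: perm_big; apply: uniq_perm; rewrite ?filter_uniq ?iota_uniq ?divisors_uniq //.
move=> k; rewrite mem_filter mem_iota -dvdn_divisors //.
case: (boolP (k %| m)%N) => //= km.
have := dvdn_leq (ltn0Sn n) km; have := dvdn_gt0 (ltn0Sn n) km; rewrite -/m in nN *; lia.
Qed.
End Ramanujan.

(** Both 48 * 36 * tau and the coefficients of E_4^3 - E_6^2 solve q G' = E_2 G,
with the same coefficient of q. *)
Theorem tau36E n : (0 < n)%N -> 36 * ramanujan_tau n = tau36 n.
Proof.
move=> n0; set D := delta_trunc n.
set G := eis n 3 240 ^+ 3 - eis n 5 (-504) ^+ 2.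
have D1 : D`_1 = 1.
  by rewrite /D delta_trunc_stable // ramanujan_tau1.
have G1 : G`_1 = 48 * 36.
  by rewrite coef_disc //= /tau36 sigma1 /musum big_seq1 dsum1.
have [R HR] := disc_ode n; have [S HS] := delta_logder n.
rewrite -/G in HR; rewrite -/D in HS.
have H : (G - (48 * 36)%:P * D)`_n = 0.
  apply: (@ode_zero n) => //.
    exists (R - (48 * 36)%:P * S).
    rewrite derivB derivM derivC mul0r add0r mulrBr ['X * (_%:P * _)]mulrCA HR HS; ring.
  by rewrite coefB coefCM G1 D1 mulr1 subrr.
move: H; rewrite coefB coefCM -mulrA coef_disc ?n0 ?leqnn // -/(ramanujan_tau n) => H.
lra.
Qed.

(** * Arithmetic of tau *)

Local Notation tau := ramanujan_tau.

Theorem tau_hecke p n : prime p -> (0 < n)%N ->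
  tau (p * n) + p%:Z ^+ 11 * (if (p %| n)%N then tau (n %/ p) else 0) = tau p * tau n.
Proof.
move=> pp n0; have p0 := prime_gt0 pp.
have H := tau36_hecke pp n0.
have E : tau36 (p * n) + p%:Z ^+ 11 * (if (p %| n)%N then tau36 (n %/ p) else 0)
   = 36 * (tau (p * n) + p%:Z ^+ 11 * (if (p %| n)%N then tau (n %/ p) else 0)).
  rewrite -tau36E ?muln_gt0 ?p0 // mulrDr; congr (_ + _).
  case: ifP => pn; last by rewrite !mulr0.
  rewrite -tau36E ?divn_gt0 //; last exact: dvdn_leq.
  by rewrite mulrCA.
move: H; rewrite E -!tau36E // => H.
apply: (@mulfI _ (36 * 36 : int)) => //; apply: (eq_from_sub H); ring.
Qed.

Lemma mod5_pow5 (d : nat) : exists c : int, d%:Z ^+ 5 = d%:Z + 5 * c.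
Proof.
have : (d ^ 5 = d %[mod 5])%N by apply: fermat_little.
move/eqP; rewrite eqn_mod_dvd ?leq_pexp2l //; last by case: d => // d; rewrite -{1}[d.+1]expn1 leq_pexp2l.
case/dvdnP => c Ec; exists c%:Z.
have le : (d <= d ^ 5)%N by case: d {Ec} => // d; rewrite -{1}[d.+1]expn1 leq_pexp2l.
by rewrite -[d%:Z]natz -natrX natz; lia.
Qed.

Lemma sigma5_mod5 n : exists c : int, (sigma 5 n)%:Z = (sigma 1 n)%:Z + 5 * c.
Proof.
rewrite !sigmaE; elim: (divisors n) => [|d s [c IH]].
  by exists 0; rewrite !big_nil.
have [e Ee] := mod5_pow5 d; exists (e + c).
by rewrite !big_cons IH Ee expr1; ring.
Qed.

Lemma sconv55_mod5 n : exists c : int, sconv 5 5 n = sconv 1 1 n + 5 * c.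
Proof.
rewrite /sconv; elim: (iota _ _) => [|m s [c IH]].
  by exists 0; rewrite !big_nil.
have [e Ee] := sigma5_mod5 m; have [f Ef] := sigma5_mod5 (n - m).
exists (e * (sigma 1 (n - m))%:Z + (sigma 1 m)%:Z * f + 5 * e * f + c).
by rewrite !big_cons IH Ee Ef; ring.
Qed.

(** Modulo 5 the series E_4 and E_8 are 1 and sigma_5 = sigma_1, so 1728 tau is
the coefficient of 1 - E_6^2, and [sconv11] evaluates sigma_1 * sigma_1. *)
Lemma tau_mod5 n : (0 < n)%N ->
  exists c : int, tau n = n%:Z * (sigma 1 n)%:Z + 5 * c.
Proof.
move=> n0; have [s Es] := sigma5_mod5 n; have [c Ec] := sconv55_mod5 n.
have H37 := sconv37 n0; have H55 := sconv55 n0; have H11 := sconv11 n0.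
have HT := tau36E n0; rewrite /tau36 in HT.
set T := tau n in HT *; set S1 := (sigma 1 n)%:Z in Es H11 *.
set C11 := sconv 1 1 n in Ec H11.
set C37 := sconv 3 7 n in H37; set M := musum n in H37 H55 HT.
set s11 := (sigma 11 n)%:Z in H37 H55 HT; set s7 := (sigma 7 n)%:Z in H37.
set s3 := (sigma 3 n)%:Z in H37 H11.
(* The combination of the six relations that isolates 3 (T - n S1) as
   a multiple of 5; then T - n S1 = 6 (T - n S1) - 5 (T - n S1). *)
pose B := 48 * s3 + 96 * s7 + (23 * 1000 + 40) * C37 + (1 * 1000 + 8) * s - (254 * 1000 + 16) * c - (21 * 1000 + 168) * s3
  - (4 * 1000 + 32) * S1 + (25 * 1000 + 401) * (n%:Z * S1) - 345 * T.
exists (2 * B - (T - n%:Z * S1)).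
have L (k a b x y : int) : a = b -> x = y -> k * a + x = k * b + y by move=> -> ->.
have H := L 96 _ _ _ _ HT (L (-80) _ _ _ _ H37 (L 504 _ _ _ _ H55 (L (2 * 1000 + 16) _ _ _ _ Es
  (L (-(508 * 1000 + 32)) _ _ _ _ Ec (L (-(42 * 1000 + 336)) _ _ _ _ H11 (erefl 0)))))).
by apply: (eq_from_sub H); rewrite /B; ring.
Qed.

Lemma tau_mod5_prime p : prime p ->
  exists c : int, tau p = p%:Z + p%:Z ^+ 2 + 5 * c.
Proof.
move=> pp; have [c ->] := tau_mod5 (prime_gt0 pp); exists c.
by rewrite sigma_prime //; ring.
Qed.

(** If h or k is even its square is a multiple of 4; if both are odd, h^2 - k^2
is. *)
Lemma rform_dvd4 (h k : nat) : exists c : int, rform h%:Z k%:Z = 4 * c.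
Proof.
rewrite /rform; case: (boolP (odd h)) => oh; last first.
  exists ((h./2)%:Z ^+ 2 * k%:Z ^+ 2 * (h%:Z ^+ 2 - k%:Z ^+ 2) ^+ 3).
  have -> : h%:Z = 2 * (h./2)%:Z by lia.
  by ring.
case: (boolP (odd k)) => ok; last first.
  exists ((k./2)%:Z ^+ 2 * h%:Z ^+ 2 * (h%:Z ^+ 2 - k%:Z ^+ 2) ^+ 3).
  have -> : k%:Z = 2 * (k./2)%:Z by lia.
  by ring.
have [-> ->] : h%:Z = 2 * (h./2)%:Z + 1 /\ k%:Z = 2 * (k./2)%:Z + 1 by lia.
set a := (h./2)%:Z; set b := (k./2)%:Z.
exists ((2 * a + 1) ^+ 2 * (2 * b + 1) ^+ 2 *
  (16 * (a ^+ 2 + a - b ^+ 2 - b) ^+ 3)).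
by ring.
Qed.

Lemma nsym_dvd4 h k : exists c : int, nsym h k = 4 * c.
Proof.
rewrite /nsym; move: k.+1 => m; elim: m h k => [|m IH] h k /=; first by exists 0.
case: eqP => _; first by exists 0.
have [c ->] := IH k (h %% k)%N; have [e ->] := rform_dvd4 (h %% k) k.
by exists (c + e); ring.
Qed.

(** The symbol takes the same value at b and p - b, so the sum doubles; this
extra factor 2 is what makes tau(p) even. *)
Lemma dsum_odd m :
  dsum (2 * m).+1 = 2 * \sum_(i < m) dsym i.+1%:Z (2 * m).+1%:Z.
Proof.
rewrite /dsum big_ord_recl /= dsymC dsym0 rform0l !add0r.
rewrite mul2n -addnn big_split_ord /= mulr_natl mulr2n; congr (_ + _).
rewrite [LHS](reindex_inj rev_ord_inj) /=; apply: eq_bigr => i _.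
rewrite -dsymNl -dsymD1; congr dsym.
by rewrite /bump; have := ltn_ord i; lia.
Qed.

Lemma dsum_odd_dvd8 m : exists c : int, dsum (2 * m).+1 = 8 * c.
Proof.
rewrite dsum_odd.
have [c ->] : exists c : int, \sum_(i < m) dsym i.+1%:Z (2 * m).+1%:Z = 4 * c.
  apply: (big_ind (fun s => exists c : int, s = 4 * c)) => [|x y [c ->] [e ->]|i _].
  - by exists 0.
  - by exists (c + e); ring.
  - exact: nsym_dvd4.
by exists c; ring.
Qed.

Lemma tau_prime_even p : prime p -> odd p -> exists c : int, tau p = 2 * c.
Proof.
move=> pp op; have [c Ec] := dsum_odd_dvd8 p./2.
have Ep : p = (2 * p./2).+1 by lia.
rewrite -Ep in Ec.
have := tau36E (prime_gt0 pp); rewrite /tau36 musum_prime // sigma_prime // Ec.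
have [e ->] : exists e : int, 1 + p%:Z ^+ 11 = 2 * e.
  have : odd (p ^ 11) by rewrite oddX op.
  rewrite -[p%:Z]natz -natrX natz => o.
  exists ((p ^ 11)./2.+1)%:Z; lia.
move=> H; have {}H : 9 * tau p = 2 * (9 * e + 691 * c).
  apply: (@mulfI _ (4 : int)) => //; apply: (eq_from_sub H); ring.
exists (9 * e + 691 * c - 4 * tau p); apply: (eq_from_sub H); ring.
Qed.

Lemma tau2 : tau 2 = - 24.
Proof.
have pr2 : prime 2 by [].
apply: (@mulfI _ (36 : int)); first by [].
rewrite (tau36E (prime_gt0 pr2)) /tau36 (musum_prime pr2) (sigma_prime _ pr2) dsum2.
ring.
Qed.

Lemma tau5 : tau 5 = 5 * 966.
Proof.
have pr5 : prime 5 by [].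
apply: (@mulfI _ (36 : int)); first by [].
rewrite (tau36E (prime_gt0 pr5)) /tau36 (musum_prime pr5) (sigma_prime _ pr5).
have H (k : int) : k = 1 + 2 * 2 ->
    \sum_(i < 2) dsym i.+1%:Z k = rform 1 k + (rform 1 2 + rform 2 k).
  move=> Ek; rewrite !big_ord_recl big_ord0 /= /bump /= addr0 dsym1n.
  by congr (_ + _); rewrite dsymC {1}Ek dsymD dsym1n.
rewrite (dsum_odd 2) H; last by [].
rewrite /rform; ring.
Qed.

(** * Lucas sequences *)

Section Lucas.
Variable R : comPzRingType.
Implicit Types P Q : R.

Fixpoint lucas P Q n : R :=
  match n with
  | 0 => 1
  | 1 => P
  | (m.+1 as k).+1 => P * lucas P Q k - Q * lucas P Q m
  end.

Lemma lucasSS P Q n : lucas P Q n.+2 = P * lucas P Q n.+1 - Q * lucas P Q n.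
Proof. by []. Qed.

Lemma lucas_scale c P Q n : lucas (c * P) (c ^+ 2 * Q) n = c ^+ n * lucas P Q n.
Proof.
suff [] : lucas (c * P) (c ^+ 2 * Q) n = c ^+ n * lucas P Q n /\
  lucas (c * P) (c ^+ 2 * Q) n.+1 = c ^+ n.+1 * lucas P Q n.+1 by [].
elim: n => [|n [IH1 IH2]]; first by rewrite /= expr0 expr1 mulr1.
by split => //; rewrite !lucasSS IH1 IH2 !exprS; ring.
Qed.

Lemma lucas4 P Q : lucas P Q 4 = P ^+ 4 - 3 * P ^+ 2 * Q + Q ^+ 2.
Proof. by rewrite /=; ring. Qed.

Lemma lucasD P Q m n :
  lucas P Q (m + n).+2 = lucas P Q m.+1 * lucas P Q n.+1 - Q * lucas P Q m * lucas P Q n.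
Proof.
suff [] : lucas P Q (m + n).+2
    = lucas P Q m.+1 * lucas P Q n.+1 - Q * lucas P Q m * lucas P Q n /\
  lucas P Q (m + n).+3
    = lucas P Q m.+1 * lucas P Q n.+2 - Q * lucas P Q m * lucas P Q n.+1 by [].
elim: n => [|n [IH1 IH2]].
  by rewrite addn0; split; rewrite !lucasSS /=; ring.
by rewrite addnS; split => //; rewrite lucasSS IH1 IH2 !lucasSS; ring.
Qed.

(** An instance of the divisibility of u_m by u_n when n + 1 divides m + 1. *)
Lemma lucas4_dvd P Q l : exists c, lucas P Q (5 * l + 4) = c * lucas P Q 4.
Proof.
elim: l => [|l [c IH]]; first by exists 1; rewrite mul1r.
exists (lucas P Q (5 * l + 4).+1 - Q * c * lucas P Q 3).
have -> : (5 * l.+1 + 4 = (5 * l + 4 + 3).+2)%N by lia.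
by rewrite lucasD IH; ring.
Qed.
End Lucas.

(** Congruences are written with explicit witnesses, which keeps the recursion
accessible to ring. *)
Lemma lucas_congr (P Q P' Q' m : int) n :
  (exists c, P = P' + m * c) -> (exists c, Q = Q' + m * c) ->
  exists c, lucas P Q n = lucas P' Q' n + m * c.
Proof.
move=> [a ->] [b ->].
suff [] : (exists c, lucas (P' + m * a) (Q' + m * b) n = lucas P' Q' n + m * c) /\
  (exists c, lucas (P' + m * a) (Q' + m * b) n.+1 = lucas P' Q' n.+1 + m * c) by [].
elim: n => [|n [[c1 IH1] [c2 IH2]]].
  by split; [exists 0; rewrite mulr0 addr0 | exists a].
split; first by exists c2.
exists (P' * c2 + a * lucas P' Q' n.+1 + m * a * c2
   - Q' * c1 - b * lucas P' Q' n - m * b * c1).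
by rewrite !lucasSS IH1 IH2; ring.
Qed.

Lemma lucas_even (P Q : int) n : (exists c, P = 2 * c) ->
  exists c, lucas P Q (2 * n).+1 = 2 * c.
Proof.
move=> HP; elim: n => [|n [c IH]]; first by [].
have [a Ea] := HP.
exists (a * lucas P Q (2 * n).+2 - Q * c).
by rewrite mulnS addSn lucasSS add1n IH {1}Ea; ring.
Qed.

(** * The 7-adic argument at p = 5 *)

Lemma sevenpow_step (t x y : {poly int}) : exists z,
  (1 + 7 * t * (x + 7 * y)) ^+ 7 = 1 + 7 * (7 * t) * (x + 7 * z).
Proof.
pose w := x + 7 * y.
(* The binomial terms of degree 2 to 7, divided by 7 * (7 * t) * 7. *)
exists (y + 3 * t * w ^+ 2 + 35 * t ^+ 2 * w ^+ 3 + 35 * 7 * t ^+ 3 * w ^+ 4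
  + 21 * 49 * t ^+ 4 * w ^+ 5 + 7 ^+ 4 * t ^+ 5 * w ^+ 6 + 7 ^+ 4 * t ^+ 6 * w ^+ 7).
by rewrite /w; ring.
Qed.

Lemma sevenpow r (x : {poly int}) : exists z,
  (1 + 7 * x) ^+ (7 ^ r) = 1 + 7 * 7 ^+ r * (x + 7 * z).
Proof.
elim: r => [|r [z IH]]; first by exists 0; rewrite expn0 !expr1 expr0; ring.
rewrite expnSr exprM IH (exprS 7 r); have [u ->] := sevenpow_step (7 ^+ r) x z.
by exists u; ring.
Qed.

(** The binomial expansion at an exponent a = 7^r * j: modulo 7^(r+2) only the
constant and the linear term remain. *)
Lemma seven_adic r j (x : {poly int}) : exists z,
  (1 + 7 * x) ^+ (7 ^ r * j) = 1 + 7 * 7 ^+ r * (j%:R * x + 7 * z).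
Proof.
rewrite exprM; have [w ->] := sevenpow r x; set t := 7 ^+ r.
elim: j => [|j [z IH]]; first by exists 0; rewrite expr0; ring.
exists (w + z + t * (x + 7 * w) * (j%:R * x + 7 * z)).
by rewrite exprS IH -natr1; ring.
Qed.

Definition lucas_mx (P Q : int) : 'M[int]_2 :=
  \matrix_(i, j) (if i == 0 then (if j == 0 then P else - Q)
                  else (if j == 0 then 1 else 0)).

Lemma lucas_mxE P Q n :
  (lucas_mx P Q ^+ n) 0 0 = lucas P Q n /\
  (lucas_mx P Q ^+ n.+1) 1 0 = lucas P Q n.
Proof.
have E10 m : (lucas_mx P Q ^+ m.+1) 1 0 = (lucas_mx P Q ^+ m) 0 0.
  by rewrite exprS mxE !big_ord_recl big_ord0 !mxE /= mul1r mul0r !addr0.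
have E00 m : (lucas_mx P Q ^+ m.+1) 0 0
    = P * (lucas_mx P Q ^+ m) 0 0 - Q * (lucas_mx P Q ^+ m) 1 0.
  rewrite exprS mxE !big_ord_recl big_ord0 !mxE /= addr0 mulNr.
  by have -> : lift ord0 ord0 = 1 :> 'I_2 by exact/val_inj.
have M0 m : (lucas_mx P Q ^+ m) 0 0 = lucas P Q m.
  elim/ltn_ind: m => -[|[|m]] IH.
  - by rewrite expr0 mxE.
  - by rewrite expr1 mxE.
  - by rewrite E00 E10 lucasSS !IH.
by rewrite E10 !M0.
Qed.

Lemma natmx_mulE (A : 'M[int]_2) d i j : (d%:R * A) i j = d%:R * A i j.
Proof.
elim: d => [|d IH]; first by rewrite !mul0r mxE.
by rewrite -!natr1 !mulrDl !mul1r mxE IH.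
Qed.

(** With j prime to 7, the entry of (1 + 7N)^a at (0, 0) is 1 + 7^(r+1) (j N_00)
modulo 7^(r+2), which is not 1 if 7 does not divide N_00. *)
Lemma lucas_seven_adic (P Q : int) (N : 'M[int]_2) a :
  lucas_mx P Q ^+ 2 = 1 + 7 * N -> (forall c, N 0 0 <> 7 * c) -> (0 < a)%N ->
  lucas P Q (2 * a) <> 1.
Proof.
move=> HN N7 a0 E.
have [j j7 Ea] := pfactor_coprime (isT : prime 7) a0.
move: Ea; rewrite mulnC; set r := logn 7 a => Ea.
have [z Hz] := seven_adic r j 'X.
have := congr1 (horner_mx N) Hz.
rewrite rmorphXn [RHS]rmorphD !rmorph1 /=.
have -> : horner_mx N (1 + 7 * 'X) = lucas_mx P Q ^+ 2.
  by rewrite HN rmorphD rmorph1 rmorphM rmorph_nat /= horner_mx_X.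
have [Z ->] : exists Z : 'M[int]_2, horner_mx N (7 * 7 ^+ r * (j%:R * 'X + 7 * z))
   = (7 * 7 ^ r)%:R * (j%:R * N + 7%:R * Z).
  exists (horner_mx N z).
  rewrite !rmorphM rmorphXn !rmorph_nat rmorphD !rmorphM !rmorph_nat /= horner_mx_X.
  by rewrite -natrX -natrM.
rewrite -Ea -exprM => /(congr1 (fun A : 'M_2 => A 0 0)).
have [-> _] := lucas_mxE P Q (2 * a).
rewrite E mxE natmx_mulE mxE mxE !natmx_mulE /= mulr1n => H1.
have /eqP : (7 * 7 ^ r)%:R * (j%:R * N 0 0 + 7%:R * Z 0 0) = 0.
  by rewrite -[LHS](addKr 1) -H1 addNr.
rewrite mulf_eq0 pnatr_eq0 muln_eq0 expn_eq0 /= => /eqP; rewrite natz => H.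
have {}H : N 0 0 * j%:Z = 7 * - Z 0 0 by lra.
move: H N7; set x := N 0 0 => H N7.
have : (7 %| x)%Z.
  rewrite -(@Gauss_dvdzl _ _ j%:Z); first by rewrite H dvdz_mulr.
  by rewrite coprimezE.
by case/dvdzP => c Ec; apply: (N7 c); rewrite Ec mulrC.
Qed.

Lemma lucas_seven_adic_entries (P Q u v w : int) a :
  P ^+ 2 - Q = 1 + 7 * u -> P = 7 * v -> Q = - 1 - 7 * w ->
  (forall c, u <> 7 * c) -> (0 < a)%N -> lucas P Q (2 * a) <> 1.
Proof.
move=> Eu Ev Ew u7.
pose N : 'M[int]_2 := \matrix_(i, j) (if i == 0 then (if j == 0 then u else - Q * v)
   else (if j == 0 then v else w)).
apply: (@lucas_seven_adic _ _ N); last by move=> c; rewrite mxE.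
apply/matrixP => i j; rewrite [RHS]mxE natmx_mulE expr2 !mxE !big_ord_recl big_ord0 !mxE /=.
case: i => [[|[|//]] ?]; case: j => [[|[|//]] ?] /=; rewrite ?mulr1n ?mulr0n.
- by rewrite addr0 -Eu; ring.
- by rewrite Ev; ring.
- by rewrite Ev; ring.
- by rewrite Ew; ring.
Qed.

Lemma lucas_966_neq1 a : (0 < a)%N -> lucas (966 : int) (5 ^+ 9) (2 * a) <> 1.
Proof.
(* The square of the companion matrix minus 1 is
   7 * (-145710, -138 * 5^9; 138, -279018), and 145710 = 5 modulo 7. *)
apply: (@lucas_seven_adic_entries _ _ (- (145 * 1000 + 710)) 138 (- (279 * 1000 + 18))).
- by ring.
- by ring.
- by ring.
- move=> c E.
  have : 7 * (c + (20 * 1000 + 815)) = - 5.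
    by apply: (eq_from_sub (esym E)); ring.
  by move: (c + _) => y; lia.
Qed.

(** * Squares among the Lucas numbers of odd index *)

Lemma prime_3mod4_factor n : (n %% 4 = 3)%N ->
  exists q, [/\ prime q, (q %| n)%N & (q %% 4 = 3)%N].
Proof.
elim/ltn_ind: n => n IH n3.
have n1 : (1 < n)%N by case: n n3 {IH} => [|[|n]].
have := pdiv_prime n1; have := pdiv_dvd n; set q := pdiv n => qn qp.
have q1 := prime_gt1 qp.
have [m Em] := dvdnP qn.
have : (q %% 4 = 3 \/ m %% 4 = 3)%N.
  have : ((m %% 4) * (q %% 4) %% 4 = 3)%N by rewrite modnMm -Em.
  have := ltn_pmod m (isT : 0 < 4)%N; have := ltn_pmod q (isT : 0 < 4)%N.
  by case: (m %% 4)%N => [|[|[|[|]]]] //; case: (q %% 4)%N => [|[|[|[|]]]] //; auto.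
case=> [q3|m3]; first by exists q.
have mn : (m < n)%N by rewrite Em ltn_Pmulr //; case: m m3 {Em}.
have [p [pp pm p3]] := IH m mn m3.
by exists p; split => //; rewrite Em dvdn_mulr.
Qed.

(** Otherwise z = x / c has z^2 = -1 in F_q, so z^q = -z as q = 3 modulo 4,
whereas z^q = z. *)
Lemma sum_squares_3mod4 q x c : prime q -> (q %% 4 = 3)%N ->
  (q %| x ^ 2 + c ^ 2)%N -> (q %| c)%N.
Proof.
move=> qp q3 H; apply/negPn/negP => qc.
have chq := pchar_Fp qp.
have c0 : (c%:R : 'F_q) != 0 by rewrite -(dvdn_pcharf chq).
pose z : 'F_q := x%:R / c%:R.
have z2 : z ^+ 2 = -1.
  move: H; rewrite (dvdn_pcharf chq) natrD !natrX addr_eq0 => /eqP Hx.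
  by rewrite expr_div_n Hx mulNr divff // expf_neq0.
have zq : z ^+ q = z by rewrite -[q in _ ^+ q](card_Fp qp) expf_card.
have Eq : q = ((q %/ 4).*2.+1.*2.+1)%N by have := divn_eq q 4; rewrite q3; lia.
have zodd n : z ^+ (n.*2.+1.*2.+1) = - z.
  rewrite exprS -[(n.*2.+1).*2]mul2n exprM z2 -mul2n exprS exprM sqrrN !expr1n.
  by rewrite mulr1 mulrN1.
have : z = - z by rewrite -(zodd (q %/ 4)%N) -Eq zq.
move/eqP; rewrite -subr_eq0 opprK -mulr2n -mulr_natl mulf_eq0 => /orP[].
  rewrite -(dvdn_pcharf chq) => /dvdn_leq /= h; have := h isT.
  move: q3 h; clear; case: q => [|[|[|q]]] // q3 h; lia.
move/eqP => z0; move/eqP: z2; rewrite z0 expr0n /= eq_sym oppr_eq0 => /eqP.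
by apply/eqP; rewrite oner_eq0.
Qed.

Fixpoint rec3 (x y : int) (n : nat) : int :=
  if n is m.+1 then rec3 y (3 * y - x) m else x.

Lemma rec3SS x y n : rec3 x y n.+2 = 3 * rec3 x y n.+1 - rec3 x y n.
Proof. by elim: n x y => [//|n IH] x y; exact: (IH y (3 * y - x)). Qed.

(** The Lucas numbers L_(2j+1) and L_(2j). *)
Definition lodd := rec3 1 4.
Definition leven := rec3 2 3.

(** This is L_(m+k) + L_(m-k) = L_m L_k for even k. *)
Lemma lodd_even_mul i j : lodd (j + 2 * i) + lodd j = lodd (j + i) * leven i.
Proof.
suff [] : (forall j, lodd (j + 2 * i) + lodd j = lodd (j + i) * leven i) /\
  (forall j, lodd (j + 2 * i.+1) + lodd j = lodd (j + i.+1) * leven i.+1) by [].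
elim: i {j} => [|i [IH1 IH2]].
  split=> j; first by rewrite muln0 !addn0 /leven /=; ring.
  by rewrite muln1 addn2 addn1 /lodd rec3SS /leven /=; ring.
split=> // j; rewrite [leven i.+2]rec3SS.
have := IH2 j.+1; have := IH1 j.+2.
have -> : (j.+2 + 2 * i = (j + 2 * i).+2)%N by lia.
have -> : (j.+1 + 2 * i.+1 = (j + 2 * i).+3)%N by lia.
have -> : (j + 2 * i.+2 = (j + 2 * i).+4)%N by lia.
have -> : (j.+2 + i = j + i.+2)%N by lia.
have -> : (j.+1 + i.+1 = j + i.+2)%N by lia.
rewrite /lodd /leven => H1 H2.
have A := rec3SS 1 4 (j + 2 * i).+2; have B := rec3SS 1 4 j.
rewrite mulrBr mulrCA -H1 -H2 A B; ring.
Qed.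

Lemma leven_dvd_lodd i j m : odd m ->
  exists c, lodd (j + 2 * i * m) + lodd j = c * leven i.
Proof.
move=> om; have -> : m = (m./2.*2.+1)%N by lia.
elim: (m./2) => [|n [c IH]].
  by exists (lodd (j + i)); rewrite muln1 lodd_even_mul.
exists (lodd (j + 2 * i * (n.*2.+1) + 2 * i + i) - lodd (j + 2 * i * (n.*2.+1) + i) + c).
have H1 := lodd_even_mul i (j + 2 * i * (n.*2.+1)).
have H2 := lodd_even_mul i (j + 2 * i * (n.*2.+1) + 2 * i).
have -> : (j + 2 * i * n.+1.*2.+1 = j + 2 * i * n.*2.+1 + 2 * i + 2 * i)%N by rewrite doubleS; nia.
rewrite !mulrDl mulNr -H1 -H2 -IH; ring.
Qed.

(** Modulo 4 the sequence L_(2i) is 2, 3, 3 repeated. *)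
Lemma leven_mod4 i : ~~ (3 %| i)%N -> exists n : nat, leven i = n%:Z /\ (n %% 4 = 3)%N.
Proof.
have pos : forall k, 0 < leven k /\ leven k < leven k.+1.
  elim=> [|k [p1 p2]]; first by [].
  by split; [exact: lt_trans p2 | rewrite /leven rec3SS -/leven; lra].
have per k : [/\ exists c, leven (3 * k) = 2 + 4 * c, exists c, leven (3 * k).+1 = 3 + 4 * c
   & exists c, leven (3 * k).+2 = 3 + 4 * c].
  have S k' : leven k'.+2 = 3 * leven k'.+1 - leven k' by exact: rec3SS.
  elim: k => [|k [[a Ea] [b Eb] [c Ec]]].
    by split; [exists 0 | exists 0 | exists 1].
  have -> : (3 * k.+1 = (3 * k).+3)%N by lia.
  have E3 := S (3 * k).+1; have E4 := S (3 * k).+2; have E5 := S (3 * k).+3.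
  rewrite Eb Ec in E3; rewrite Ec E3 in E4; rewrite E3 E4 in E5.
  split; [exists (3 * c - b + 1) | exists (9 * c - 3 * b - c + 3) | exists (3 * (9 * c - 3 * b - c + 3) - (3 * c - b + 1) + 1)].
  - by rewrite E3; ring.
  - by rewrite E4; ring.
  - by rewrite E5; ring.
move=> i3; have [p _] := pos i.
exists `|leven i|%N; split; first by rewrite gtz0_abs.
have [_ [b Eb] [c Ec]] := per (i %/ 3)%N.
have : (i = (3 * (i %/ 3)).+1 \/ i = (3 * (i %/ 3)).+2)%N by lia.
by case=> Ei; move: p; rewrite Ei ?Eb ?Ec; lia.
Qed.

(** Cohn's argument.  Write j = j0 + 2 * 3^s * i with j0 in {0, 1} and i > 0
prime to 3.  Then L_(2i) divides L_(2j+1) + L_(2 j0 + 1), which is x^2 + 1 or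
x^2 + 4; but L_(2i) = 3 modulo 4 has a prime factor that is 3 modulo 4. *)
Lemma lodd_square j (x : int) : lodd j = x ^+ 2 -> (j <= 1)%N.
Proof.
move=> E; rewrite leqNgt; apply/negP => j2.
have [j0 [c [m [Ej m0 Ec cs]]]] : exists j0 c m, [/\ (j = j0 + 2 * m)%N, (0 < m)%N,
    lodd j0 = (c ^ 2)%N%:Z & (c = 1 \/ c = 2)%N].
  case: (boolP (odd j)) => oj.
    exists 1%N, 2%N, (j./2)%N; split; [lia | lia | by [] | by right].
  exists 0%N, 1%N, (j./2)%N; split; [lia | lia | by [] | by left].
have [i i3 Em] := pfactor_coprime (isT : prime 3) m0.
have {}i3 : ~~ (3 %| i)%N by rewrite -prime_coprime.
have [n [En n3]] := leven_mod4 i3.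
have o3 : odd (3 ^ logn 3 m) by rewrite oddX orbT.
have [d Hd] := leven_dvd_lodd i j0 o3.
rewrite -mulnA -Em -Ej E Ec En in Hd.
have [q [qp qn q3]] := prime_3mod4_factor n3.
have H : (q %| `|x| ^ 2 + c ^ 2)%N.
  apply: dvdn_trans qn _; apply/dvdnP; exists `|d|%N.
  by move/(congr1 absz): Hd; rewrite abszM absz_nat => <-; lia.
have := sum_squares_3mod4 qp q3 H.
case: cs => ->; first by rewrite dvdn1 => /eqP q1; rewrite q1 in qp.
by move/dvdn_leq => /(_ isT); case: q q3 {qp qn H} => [|[|[|q]]] // q3 h; lia.
Qed.

(** * The conic for tau(p^4) *)

(** Vieta jumping: if (y, x) is a point with y < x, then so is (3 y - x, y), and
it is smaller as long as y >= 3. *)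
Lemma lodd_descent (y x : int) : 0 < y -> y < x ->
  y ^+ 2 - 3 * y * x + x ^+ 2 = 5 -> exists j, y = lodd j /\ x = lodd j.+1.
Proof.
have [n] := ubnP `|y|%N; elim: n y x => // n IH y x yn y0 yx E.
have key : x * (3 * y - x) = y ^+ 2 - 5 by rewrite -E; ring.
case: (lerP 3 y) => y3.
  have z0 : 0 < 3 * y - x by nia.
  have zy : 3 * y - x < y by nia.
  have zn : (absz (3 * y - x)%R < n)%N by lia.
  have [|j [Ez Ey]] := IH (3 * y - x) y zn z0 zy; first by rewrite -E; ring.
  exists j.+1; split=> //; rewrite [RHS]rec3SS -/lodd -Ey -Ez; ring.
have [y1|y2] : y = 1 \/ y = 2 by lia.
  exists 0%N; rewrite y1; split=> //; move: E; rewrite y1 => E.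
  have : (x - 4) * (x + 1) = 0 by rewrite -[RHS](subrr 5) -{1}E; ring.
  move/eqP; rewrite mulf_eq0 => /orP[] /eqP; rewrite /lodd /=; lia.
move: E; rewrite y2 => E.
have [x6|x6] : (x <= 6) \/ (7 <= x) by lia.
  have : [\/ x = 3, x = 4, x = 5 | x = 6].
    by have [?|[?|[?|?]]] : x = 3 \/ x = 4 \/ x = 5 \/ x = 6 by [lia]; constructor.
  by case=> Ex; move: E; rewrite Ex.
nia.
Qed.

(** The sign is settled modulo 4, as P is even and Q odd.  By the descent P^2 is
a Lucas number of odd index, hence 1 or 4; so P^2 = 4 and (Q - 1)(Q - 11) = 0. *)
Lemma lucas_quartic (P Q : int) : (exists c, P = 2 * c) -> (exists c, Q = 2 * c + 1) ->
  0 < Q -> absz (P ^+ 4 - 3 * P ^+ 2 * Q + Q ^+ 2)%R = 5%N -> Q <= 11.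
Proof.
move=> [a Ea] [b Eb] Q0 E5.
have {}E5 : P ^+ 4 - 3 * P ^+ 2 * Q + Q ^+ 2 = 5.
  have [//|E] : P ^+ 4 - 3 * P ^+ 2 * Q + Q ^+ 2 = 5 \/ P ^+ 4 - 3 * P ^+ 2 * Q + Q ^+ 2 = - 5.
    by move: E5; move: (_ + _) => z; lia.
  have : 4 * (4 * a ^+ 4 - 3 * a ^+ 2 * Q + b ^+ 2 + b) + 1 = -5.
    by rewrite -E Ea Eb; ring.
  by move: (_ + b) => z; lia.
have E : (P ^+ 2) ^+ 2 - 3 * P ^+ 2 * Q + Q ^+ 2 = 5 by rewrite -E5; ring.
have P0 : 0 < P ^+ 2.
  rewrite lt0r sqr_ge0 andbT; apply/eqP => Pz; move: E; rewrite Pz => E.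
  have : 4 * (b ^+ 2 + b) + 1 = 5 by rewrite -E Eb; ring.
  move=> H; have : b ^+ 2 + b = 1 by lia.
  move=> {}H; have : b <= -2 \/ b = -1 \/ b = 0 \/ 1 <= b by lia.
  by case=> [?|[b1|[b0|?]]]; nia.
have P4 : P ^+ 2 = 4.
  have sq j : lodd j = P ^+ 2 -> P ^+ 2 = 4.
    move=> Ej; have := lodd_square Ej; case: j Ej => [|[|//]] Ej _ //.
    move: Ej; rewrite /lodd /= Ea => Ej.
    have : 2 * (2 * a ^+ 2) = 1 by apply: (eq_from_sub (esym Ej)); ring.
    by move: (2 * a ^+ 2) => z; lia.
  case: (ltrgtP (P ^+ 2) Q) => PQ.
  - by have [j [/esym/sq]] := lodd_descent P0 PQ E.
  - have [|j [_ /esym/sq //]] := lodd_descent Q0 PQ; by rewrite -E; ring.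
  - have := sqr_ge0 P; move: E; rewrite -PQ => E _.
    have : - (P ^+ 2) ^+ 2 = 5 by rewrite -E; ring.
    by have := sqr_ge0 (P ^+ 2); lra.
move: E; rewrite P4 => E.
have : (Q - 1) * (Q - 11) = 0 by rewrite -[RHS](subrr 5) -{1}E; ring.
by move/eqP; rewrite mulf_eq0 => /orP[] /eqP; lia.
Qed.

(** * Values that are powers of 5 *)

Definition is_pow5 (z : int) := exists i, `|z|%N = (5 ^ i)%N.

Lemma is_pow5M a b : is_pow5 (a * b) -> is_pow5 a.
Proof.
case=> i; rewrite abszM => E.
have : (`|a| %| 5 ^ i)%N by rewrite -E dvdn_mulr.
by move/(dvdn_pfactor _ _ (isT : prime 5)) => [m _ Em]; exists m.
Qed.

Lemma pow5_even z : is_pow5 (2 * z) -> False.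
Proof.
case=> i; rewrite abszM => /(congr1 odd); rewrite oddM oddX orbT /=; lia.
Qed.

Lemma pow5_ndiv z : is_pow5 z -> (forall c, z <> 5 * c) -> `|z|%N = 1%N.
Proof.
case=> -[|i] E H; first by rewrite E.
case: (H (if 0 <= z then (5 ^ i)%N%:Z else - (5 ^ i)%N%:Z)).
by move: E; rewrite expnS; case: ifP; lia.
Qed.

Lemma pow5_once z c : is_pow5 z -> z = 5 * c -> (forall d, c <> 5 * d) -> `|z|%N = 5%N.
Proof.
move=> z5 Ez Hc; rewrite Ez abszM (pow5_ndiv _ Hc) //.
by apply: (@is_pow5M _ 5); rewrite mulrC -Ez.
Qed.

Lemma dvd5_sqr (x : int) : (5 %| x * x)%Z -> exists f, x = 5 * f.
Proof.
rewrite dvdzE abszM Euclid_dvdM // orbb => H.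
have /dvdzP[f ->] : (5 %| x)%Z by rewrite dvdzE.
by exists f; rewrite mulrC.
Qed.

(** The value is (P^2 + Q)^2 - 5 P^2 Q: if 5 divides it, then 25 divides the
square, while 5 divides neither Q nor P^2 = - Q. *)
Lemma lucas4_val5 (P Q c : int) : (forall d, Q <> 5 * d) ->
  lucas P Q 4 = 5 * c -> forall d, c <> 5 * d.
Proof.
move=> Q5 E d Ed; move: E; rewrite lucas4 Ed => E.
have : (5 %| (P ^+ 2 + Q) ^+ 2)%Z.
  apply/dvdzP; exists (5 * d + P ^+ 2 * Q).
  by apply: (eq_from_sub E); ring.
rewrite expr2 => /dvd5_sqr[e Ee].
have HP : P ^+ 2 = 5 * e - Q by rewrite -Ee; ring.
have HQ : Q * Q = 5 * (d - e ^+ 2 + e * Q).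
  apply: (@mulfI _ (5 : int)) => //; apply: (eq_from_sub E).
  have -> : P ^+ 4 = (P ^+ 2) ^+ 2 by rewrite -exprM.
  by rewrite HP; ring.
have : (5 %| Q * Q)%Z by apply/dvdzP; eexists; rewrite HQ mulrC.
by move/dvd5_sqr => [f Ef]; apply: (Q5 f).
Qed.

Lemma exp_congr (a b m : int) n : (exists c, a = b + m * c) ->
  exists c, a ^+ n = b ^+ n + m * c.
Proof.
case=> e ->; elim: n => [|n [d IH]]; first by exists 0; rewrite mulr0 addr0.
by exists (b * d + e * b ^+ n + m * e * d); rewrite !exprS IH; ring.
Qed.

Lemma lucas_0N1 k : ~~ odd k -> lucas (0 : int) (-1) k = 1.
Proof.
move=> ok; have -> : k = (2 * k./2)%N by lia.
elim: k./2 => [|s IH] //.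
by rewrite mulnS !addSn add0n lucasSS IH mul0r add0r mulN1r opprK.
Qed.

(** The roots of the characteristic polynomial are p and p^2 modulo 5.  For
p = 2, 3, 4 modulo 5 the terms of even index are periodic and prime to 5; for
p = 1 the k-th term is k + 1. *)
Lemma lucas_mod5 p k (P Q : int) : prime p -> p != 5%N ->
  (exists c, P = p%:Z + p%:Z ^+ 2 + 5 * c) -> Q = p%:Z ^+ 11 -> ~~ odd k ->
  (exists c, lucas P Q k = 5 * c) ->
  (exists q : nat, p = (1 + 5 * q)%N) /\ (5 %| k.+1)%N.
Proof.
move=> pp p5 [c0 HP] HQ ok [c Hc].
have red (P' Q' : int) : (exists c, P = P' + 5 * c) -> (exists c, Q = Q' + 5 * c) ->
    (5 %| lucas P' Q' k)%Z.
  move=> H1 H2; have [d Ed] := lucas_congr k H1 H2.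
  by apply/dvdzP; exists (c - d); rewrite mulrBl -[c * 5]mulrC -Hc Ed; ring.
have [r [q [Ep r4 r0]]] : exists r q : nat, [/\ (p = r + 5 * q)%N, (r <= 4)%N & (0 < r)%N].
  exists (p %% 5)%N, (p %/ 5)%N; split; [by rewrite addnC mulnC -divn_eq | by rewrite -ltnS ltn_pmod |].
  by rewrite lt0n -/(dvdn 5 p) dvdn_prime2 // eq_sym.
have Hp : p%:Z = r%:Z + 5 * q%:Z by rewrite Ep; lia.
have pw m := @exp_congr p%:Z r%:Z 5 m (ex_intro _ q%:Z Hp).
have [d2 E2] := pw 2%N; have [d3 E3] := pw 3%N; have [d5 E5] := mod5_pow5 p.
have E11 : p%:Z ^+ 11 = p%:Z ^+ 3
    + 5 * (p%:Z * d5 * (2 * p%:Z + 5 * d5)).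
  have -> : p%:Z ^+ 11 = p%:Z * (p%:Z ^+ 5) ^+ 2 by ring.
  by rewrite E5; ring.
have {}red (P' Q' : int) : (exists c, r%:Z + r%:Z ^+ 2 = P' + 5 * c) ->
    (exists c, r%:Z ^+ 3 = Q' + 5 * c) -> (5 %| lucas P' Q' k)%Z.
  move=> [a Ea] [b Eb]; apply: red.
    exists (a + q%:Z + d2 + c0); rewrite HP E2 Hp.
    by apply: (eq_from_sub Ea); ring.
  by exists (b + d3 + p%:Z * d5 * (2 * p%:Z + 5 * d5)); rewrite HQ E11 E3 Eb; ring.
have [s Es] : exists s, k = (2 * s)%N by exists k./2; lia.
case: r r4 r0 Ep Hp pw E2 E3 red => [|[|[|[|[|]]]]] // _ _ Ep _ _ _ _ red.
- have {}red := red 2 1 ltac:(by exists 0) ltac:(by exists 0).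
  have E m : lucas (2 : int) 1 m = m.+1%:Z.
    suff [] : lucas (2 : int) 1 m = m.+1%:Z /\ lucas (2 : int) 1 m.+1 = m.+2%:Z by [].
    by elim: m => [|m [I1 I2]] //; split=> //; rewrite lucasSS I1 I2; lia.
  by move: red; rewrite E => red; split; [exists q | lia].
- have {}red := red 1 3 ltac:(by exists 1) ltac:(by exists 1).
  have : exists a b, (lucas (1 : int) 3 k = 1 + 5 * a /\ lucas (1 : int) 3 k.+1 = 1 + 5 * b)
      \/ (lucas (1 : int) 3 k = 3 + 5 * a /\ lucas (1 : int) 3 k.+1 = 5 * b).
    rewrite Es; elim: s {Es} => [|s [a [b IH]]]; first by exists 0, 0; left.
    rewrite mulnS !addSn add0n !lucasSS; case: IH => [[-> ->]|[-> ->]].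
      by exists (b - 3 * a - 1), (- 2 * b - 3 * a - 1); right; split; ring.
    by exists (b - 3 * a - 2), (- 2 * b - 3 * a - 2); left; split; ring.
  by move: red => /[swap] -[a [b [[-> _]|[-> _]]]]; lia.
- have {}red := red 2 2 ltac:(by exists 2) ltac:(by exists 5).
  have : exists a b, (lucas (2 : int) 2 k = 1 + 5 * a /\ lucas (2 : int) 2 k.+1 = 2 + 5 * b)
      \/ (lucas (2 : int) 2 k = 2 + 5 * a /\ lucas (2 : int) 2 k.+1 = 5 * b).
    rewrite Es; elim: s {Es} => [|s [a [b IH]]]; first by exists 0, 0; left.
    rewrite mulnS !addSn add0n !lucasSS; case: IH => [[-> ->]|[-> ->]].
      by exists (2 * b - 2 * a), (2 * b - 4 * a); right; split; ring.
    by exists (2 * b - 2 * a - 1), (2 * b - 4 * a - 2); left; split; ring.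
  by move: red => /[swap] -[a [b [[-> _]|[-> _]]]]; lia.
- have {}red := red 0 (-1) ltac:(by exists 4) ltac:(by exists 13).
  by rewrite lucas_0N1 in red.
Qed.

Lemma tau1 : tau 1 = 1. Proof. exact: ramanujan_tau1. Qed.

Lemma tau_pow_mul p m k : prime p -> ~~ (p %| m)%N -> (0 < m)%N ->
  tau (p ^ k * m) = lucas (tau p) (p%:Z ^+ 11) k * tau m.
Proof.
move=> pp pm m0; have p0 := prime_gt0 pp.
suff [] : tau (p ^ k * m) = lucas (tau p) (p%:Z ^+ 11) k * tau m /\
  tau (p ^ k.+1 * m) = lucas (tau p) (p%:Z ^+ 11) k.+1 * tau m by [].
elim: k => [|k [I1 I2]].
  split; first by rewrite mul1n mul1r.
  have := tau_hecke pp m0; rewrite (negbTE pm) mulr0 addr0 => H.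
  by rewrite expn1 H.
split=> //.
have n0 : (0 < p ^ k.+1 * m)%N by rewrite muln_gt0 expn_gt0 p0.
have := tau_hecke pp n0; rewrite I2 mulnA -expnS.
have -> : (p ^ k.+1 * m = p * (p ^ k * m))%N by rewrite expnS mulnA.
rewrite dvdn_mulr // mulKn // I1 lucasSS => H.
by apply: (eq_from_sub H); ring.
Qed.

(** The cases p = 2, p = 5 and p <> 2, 5 are treated as explained at the top; in
the last one it is the hypothesis that 5 divides the term that is refuted. *)
Lemma pow5_tau_prime_pow p k : prime p -> (0 < k)%N ->
  is_pow5 (lucas (tau p) (p%:Z ^+ 11) k) ->
  `|lucas (tau p) (p%:Z ^+ 11) k|%N = 1%N.
Proof.
move=> pp k0 U5; set U := lucas _ _ k in U5 *.
case: (eqVneq p 2%N) => [p2|p2].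
  have [c Ec] : exists c, U = 0 + 2 * c.
    have [c Ec] := @lucas_congr (tau p) (p%:Z ^+ 11) 0 0 2 k
      ltac:(by exists (-12); rewrite p2 tau2) ltac:(by exists (2 ^+ 10); rewrite p2; ring).
    exists c; rewrite /U Ec; congr (_ + _).
    by case: k k0 {U U5 c Ec} => // -[|k] _ //; rewrite lucasSS !mul0r subrr.
  by case: (@pow5_even c); rewrite -[2 * c]add0r -Ec.
have op : odd p by case/even_prime: pp p2 => // ->.
have Pe := tau_prime_even pp op.
have ok : ~~ odd k.
  apply/negP => ok; have [c Ec] := lucas_even (p%:Z ^+ 11) k./2 Pe.
  apply: (@pow5_even c); rewrite -Ec.
  by have -> : (2 * k./2).+1 = k by lia.
case: (eqVneq p 5%N) => [p5|p5].
  exfalso; move: U5; rewrite /U p5 tau5.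
  have -> : 5%N%:Z ^+ 11 = 5 ^+ 2 * 5 ^+ 9 :> int by ring.
  rewrite lucas_scale mulrC => /is_pow5M; set u := lucas 966 _ k => u5.
  have u1 : `|u|%N = 1%N.
    apply: (pow5_ndiv u5) => c Ec.
    have [e Ee] := @lucas_congr 966 (5 ^+ 9) 1 0 5 k
      ltac:(by exists 193) ltac:(by exists (5 ^+ 8); rewrite add0r -exprS).
    have E1 m : lucas (1 : int) 0 m = 1.
      elim/ltn_ind: m => -[|[|m]] IH //.
      by rewrite lucasSS IH // mul1r mul0r subr0.
    by move: Ee; rewrite E1 -/u Ec; lia.
  (* Modulo 3 the parameters are 0 and -1, which decides the sign. *)
  have [e Ee] := @lucas_congr 966 (5 ^+ 9) 0 (-1) 3 k
    ltac:(by exists 322) ltac:(by exists (651 * 1000 + 42); ring).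
  rewrite lucas_0N1 // -/u in Ee.
  have ue : u = 1 by lia.
  apply: (@lucas_966_neq1 k./2); first by lia.
  by have -> : (2 * k./2)%N = k by lia.
have p3 : (3 <= p)%N by have := prime_gt1 pp; lia.
have Q5 d : p%:Z ^+ 11 <> 5 * d.
  move=> E; have : (5 %| p ^ 11)%N.
    apply/dvdnP; exists `|d|%N; rewrite mulnC.
    by have := congr1 absz E; rewrite abszM abszX.
  by rewrite Euclid_dvdX // dvdn_prime2 // eq_sym (negbTE p5).
apply: pow5_ndiv => // c Ec.
have [[q Eq] k5] : (exists q : nat, p = (1 + 5 * q)%N) /\ (5 %| k.+1)%N.
  by apply: (lucas_mod5 pp p5 (tau_mod5_prime pp) erefl ok); exists c.
have Eqz : p%:Z = 1 + 5 * q%:Z by rewrite Eq; lia.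
have [l El] : exists l, k = (5 * l + 4)%N by exists (k %/ 5)%N; lia.
have [d Ed] := lucas4_dvd (tau p) (p%:Z ^+ 11) l.
have U4 : is_pow5 (lucas (tau p) (p%:Z ^+ 11) 4).
  by apply: (@is_pow5M _ d); rewrite mulrC -Ed -El.
have [c4 Ec4] : exists c4, lucas (tau p) (p%:Z ^+ 11) 4 = 5 * c4.
  have [e Ee] := @lucas_congr (tau p) (p%:Z ^+ 11) 2 1 5 4 ltac:(
    by have [e ->] := tau_mod5_prime pp; exists (q%:Z + 2 * q%:Z + 5 * q%:Z ^+ 2 + e);
       rewrite Eqz; ring)
    ltac:(by have := @exp_congr p%:Z 1 5 11 (ex_intro _ q%:Z Eqz); rewrite expr1n).
  by exists (1 + e); rewrite Ee lucas4; ring.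
have := pow5_once U4 Ec4 (lucas4_val5 Q5 Ec4).
rewrite lucas4 => E4.
have : p%:Z ^+ 11 <= 11.
  apply: lucas_quartic E4 => //; last by rewrite exprn_gt0 // ltz_nat prime_gt0.
  exists (p ^ 11)./2%:Z.
  have : odd (p ^ 11) by rewrite oddX op.
  by rewrite -[p%:Z]natz -natrX natz => o; lia.
rewrite -[p%:Z]natz -natrX natz lez_nat leqNgt => /negP[].
exact: (ltn_expl 11 (ltnW p3)).
Qed.

Lemma pow5_tau n : (0 < n)%N -> is_pow5 (tau n) -> `|tau n|%N = 1%N.
Proof.
elim/ltn_ind: n => n IH n0 H.
case: (leqP n 1) => n1; first by have -> : n = 1%N by [lia]; rewrite tau1.
have pp := pdiv_prime n1; set p := pdiv n in pp.
have [m pm En] := pfactor_coprime pp n0; rewrite prime_coprime // in pm.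
have k0 : (0 < logn p n)%N by rewrite logn_gt0 mem_primes pp n0 pdiv_dvd.
have m0 : (0 < m)%N by case: m {pm} En => // En; rewrite En in n0.
move: H; rewrite {1 2}En mulnC (tau_pow_mul _ pp pm m0) => H.
rewrite abszM (pow5_tau_prime_pow pp k0 (is_pow5M H)) mul1n.
apply: IH => //; last by rewrite mulrC in H; exact: is_pow5M H.
rewrite [X in (_ < X)%N]En ltn_Pmulr //.
by rewrite -(exp1n (logn p n)) ltn_exp2r // prime_gt1.
Qed.

Theorem theorem1p2 (m n : nat) (hm : (1 <= m)%N) (hn : (1 <= n)%N) :
  ramanujan_tau n <> (5 : int) ^+ m /\ ramanujan_tau n <> - ((5 : int) ^+ m).
Proof.
have key : `|tau n|%N <> (5 ^ m)%N.
  move=> E; have := pow5_tau hn (ex_intro _ m E).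
  by rewrite E => /eqP; rewrite -[X in _ == X](expn0 5) eqn_exp2l //; lia.
by split=> E; apply: key; rewrite E ?abszN abszX.
Qed.
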